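(* Let $0<s<1$ and consider directed last passage percolation on the $n\times n$ grid with i.i.d. Bernoulli($s$) vertex weights. Suppose that the curvature power $\kappa$ of the shape function $g$ at $(1,1)$ satisfies $1\le\kappa<+\infty$. Then, with probability exponentially close to $1$, all the geodesics from $(0,0)$ to $(n,n)$ are within the cylinder centered on the main diagonal and of width $O\big(n^{\frac{2\kappa+2}{2\kappa+3}}\sqrt{\ln n}\big)$. That is, there exist constants $C>0$, $a>0$ and $N$ (not depending on $n$) such that for all $n\ge N$, with probability at least $1-2\exp(-n^{a})$, every vertex $(x,y)$ of every geodesic from $(0,0)$ to $(n,n)$ satisfies $|x-y|\le C\,n^{\frac{2\kappa+2}{2\kappa+3}}\sqrt{\ln n}$.
   Context: Model: the vertices of the grid are $v\in\{0,1,\dots,n\}^2$, each carrying a weight $w(v)\in\{0,1\}$; all weights are independent with $\mathbb{P}(w(v)=1)=s=1-\mathbb{P}(w(v)=0)$, $0<s<1$. A directed path from $(0,0)$ to $(n_1,n_2)$ is a sequence of vertices $v_0=(0,0),v_1,\dots,v_{n_1+n_2}=(n_1,n_2)$ with each increment $v_{i+1}-v_i\in\{(1,0),(0,1)\}$. The last passage time is $T(n_1,n_2)=\max_{\pi}\sum_{v\in\pi\setminus\{(0,0)\}}w(v)$, the maximum being over all directed paths $\pi$ from $(0,0)$ to $(n_1,n_2)$ (the weight at the starting vertex is excluded). A geodesic from $(0,0)$ to $(n,n)$ is any directed path attaining $T(n,n)$. Shape function: $g(x,y)=\lim_{n\to\infty}\mathbb{E}T(nx,ny)/n$ for $x,y>0$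 (coordinates $nx,ny$ rounded down to integers); the limit exists and $g$ is symmetric and concave. Put $g_\perp(q)=g(1-q,1+q)$ for $q\in(-1,1)$. Curvature power at $(1,1)$: if $g$ is differentiable at $(1,1)$, then $g$ has curvature power $\kappa$ at $(1,1)$ if there exist $\delta>0$ and positive constants $c,C'$ such that $c|z|^{\kappa}\le |g((1,1)+z)-g(1,1)|\le C'|z|^{\kappa}$ for all $z\in\mathbb{R}^2$ with $z\cdot(1,1)=0$ and $|z|<\delta$; if $g$ is not differentiable at $(1,1)$, set $\kappa=1$. The requirement $1\le\kappa<\infty$ is equivalent to: there exist $\delta>0$ and $c,C'>0$ with $c|q|^{\kappa}\le|g_\perp(q)-g_\perp(0)|\le C'|q|^{\kappa}$ for all $q\in(-1,1)$ with $|q|<\delta$. *)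

(* Defs.v *)
From HB Require Import structures.
From mathcomp Require Import all_boot all_order all_algebra.
From mathcomp Require Import all_classical all_reals all_analysis.

Set Implicit Arguments.
Unset Strict Implicit.
Unset Printing Implicit Defensive.

Import Order.TTheory GRing.Theory Num.Theory.
Import numFieldNormedType.Exports.

Local Open Scope classical_set_scope.
Local Open Scope ring_scope.

Definition mutually_independent (d d' : measure_display)
    (T : measurableType d) (U : measurableType d') (R : realType)
    (P : probability T R) (I : choiceType) (X : I -> {RV P >-> U}) : Prop :=
  forall (J : seq I) (B : I -> set U),
    uniq J -> (forall i, i \in J -> measurable (B i)) ->
    P (\bigcap_(i in [set` J]) (X i @^-1` B i)) =
    (\prod_(i <- J) P (X i @^-1` B i))%E.

Definition iid_bernoulli (d : measure_display) (T : measurableType d)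
    (R : realType) (P : probability T R) (I : choiceType)
    (w : I -> {RV P >-> bool}) (s : R) : Prop :=
  mutually_independent w /\ forall i, P (w i @^-1` [set true]) = s%:E.

Definition vertex : Type := (nat * nat)%type.

Definition step : rel vertex :=
  fun u v => (v == (u.1.+1, u.2)) || (v == (u.1, u.2.+1)).

(* A path v_0 = (0,0), v_1, ..., v_k is represented by p = [:: v_1; ...; v_k];
   its length k = z.1 + z.2 is forced by the steps. *)
Definition directed_path (z : vertex) (p : seq vertex) : bool :=
  path step (0, 0)%N p && (last (0, 0)%N p == z).

Definition passage_time (w : vertex -> bool) (p : seq vertex) : nat :=
  (\sum_(v <- p) w v)%N.

Definition grid_seq (z : vertex) (p : seq ('I_z.1.+1 * 'I_z.2.+1)) :
    seq vertex :=
  [seq (nat_of_ord v.1, nat_of_ord v.2) | v <- p].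

(* The tuples below encode, up to grid_seq, all directed paths to z: see
   grid_seq_surj. *)
Definition last_passage_time (w : vertex -> bool) (z : vertex) : nat :=
  (\max_(p : (z.1 + z.2)%N.-tuple ('I_z.1.+1 * 'I_z.2.+1)
         | directed_path z (grid_seq p)) passage_time w (grid_seq p))%N.

Definition geodesic (w : vertex -> bool) (z : vertex) (p : seq vertex) : bool :=
  directed_path z p && (passage_time w p == last_passage_time w z).

Lemma grid_seq_surj (z : vertex) (p : seq vertex) : directed_path z p ->
  exists q : (z.1 + z.2)%N.-tuple ('I_z.1.+1 * 'I_z.2.+1), grid_seq q = p.
Proof.
case/andP=> hp /eqP hl.
have key : forall (q : seq vertex) (u : vertex), path step u q ->
    (u.1 + u.2 + size q = (last u q).1 + (last u q).2)%N /\
    forall v, v \in u :: q -> (v.1 <= (last u q).1)%N /\ (v.2 <= (last u q).2)%N.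
  elim=> [|x q IH] u /=.
    by rewrite addn0; split=> // v; rewrite inE => /eqP ->.
  case/andP=> hux /IH [h1 h2]; split.
    by rewrite -h1; case/orP: hux => /eqP -> /=; rewrite ?addnS ?addSn.
  move=> v; rewrite inE => /orP[/eqP ->|/h2 //].
  have [a b] := h2 x (mem_head _ _).
  case/orP: hux a b => /eqP -> /= a b; split=> //; exact: ltnW.
have [] := key _ _ hp; rewrite hl /= !add0n => hsz hb.
pose q := [seq (inord v.1 : 'I_z.1.+1, inord v.2 : 'I_z.2.+1) | v <- p].
have hq : size q == (z.1 + z.2)%N by rewrite size_map hsz.
exists (Tuple hq); rewrite /grid_seq /= -map_comp -[RHS]map_id.
apply/eq_in_map => v vp /=.
have [a b] := hb v (mem_behead (s := (0, 0)%N :: p) vp).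
by rewrite !inordK ?ltnS //; case: v {vp a b}.
Qed.

Lemma last_passage_time_ge (w : vertex -> bool) (z : vertex) (p : seq vertex) :
  directed_path z p -> (passage_time w p <= last_passage_time w z)%N.
Proof.
move=> hp; have [q hq] := grid_seq_surj hp; rewrite -hq in hp *.
exact: (leq_bigmax_cond (F := fun q : _.-tuple _ => passage_time w (grid_seq q))
  q hp).
Qed.

Lemma geodesic_exists (w : vertex -> bool) (z : vertex) :
  exists p, geodesic w z p.
Proof.
pose f (q : (z.1 + z.2)%N.-tuple ('I_z.1.+1 * 'I_z.2.+1)) :=
  passage_time w (grid_seq q).
have line : forall (u : vertex) (k : nat), exists2 p, path step u p &
    last u p = (u.1 + k, u.2)%N.
  move=> [a b] k; elim: k a => [|k IH] a; first by exists [::]; rewrite /= ?addn0.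
  have [p hp hl] := IH a.+1; exists ((a.+1, b) :: p) => /=.
    by rewrite hp /step eqxx.
  by rewrite hl /= addSnnS.
have line2 : forall (u : vertex) (k : nat), exists2 p, path step u p &
    last u p = (u.1, u.2 + k)%N.
  move=> [a b] k; elim: k b => [|k IH] b; first by exists [::]; rewrite /= ?addn0.
  have [p hp hl] := IH b.+1; exists ((a, b.+1) :: p) => /=.
    by rewrite hp /step eqxx orbT.
  by rewrite hl /= addSnnS.
have [p1 hp1 hl1] := line (0, 0)%N z.1.
have [p2 hp2 hl2] := line2 (last (0, 0)%N p1) z.2.
have hp : directed_path z (p1 ++ p2).
  by rewrite /directed_path cat_path hp1 hp2 last_cat hl2 hl1 /= !add0n; case: (z).
have [q0 hq0] := grid_seq_surj hp.
have c : (0 < #|[pred q : (z.1 + z.2)%N.-tuple ('I_z.1.+1 * 'I_z.2.+1)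
                 | directed_path z (grid_seq q)]|)%N.
  by apply/card_gt0P; exists q0; rewrite inE hq0.
have [q hq e] := eq_bigmax_cond f c.
by exists (grid_seq q); rewrite /geodesic -/(f q) -e eqxx andbT.
Qed.

Definition mean_passage_time (d : measure_display) (T : measurableType d)
    (R : realType) (P : probability T R) (w : vertex -> {RV P >-> bool})
    (z : vertex) : R :=
  fine 'E_P[fun t => (last_passage_time (fun v => w v t) z)%:R].

(* Only meaningful on the open positive quadrant, where Num.truncn is the floor
   and the limit exists. *)
Definition shape_function (d : measure_display) (T : measurableType d)
    (R : realType) (P : probability T R) (w : vertex -> {RV P >-> bool})
    (z : R^o * R^o) : R^o :=
  lim ((mean_passage_time w (Num.truncn (n%:R * z.1), Num.truncn (n%:R * z.2))
        / n%:R) @[n --> \oo]).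

Definition euclidean_norm (R : realType) (z : R^o * R^o) : R :=
  Num.sqrt (z.1 ^+ 2 + z.2 ^+ 2).

Definition dot_product (R : realType) (z z' : R^o * R^o) : R :=
  z.1 * z'.1 + z.2 * z'.2.

(* At a point of non-differentiability the curvature power is 1 by convention. *)
Definition has_curvature_power_11 (R : realType) (g : R^o * R^o -> R^o)
    (kappa : R) : Prop :=
  let o : R^o * R^o := (1, 1) in
  (differentiable g o /\
   exists delta c C' : R, [/\ 0 < delta, 0 < c, 0 < C' &
     forall z : R^o * R^o, dot_product z o = 0 -> euclidean_norm z < delta ->
       c * euclidean_norm z `^ kappa <= `|g (o + z) - g o|
         <= C' * euclidean_norm z `^ kappa]) \/
  (~ differentiable g o /\ kappa = 1).

(* Main.v *)
Require Import Defs.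
From HB Require Import structures.
From mathcomp Require Import all_boot all_order all_algebra.
From mathcomp Require Import all_classical all_reals all_analysis.
From mathcomp Require Import measurable_realfun.
From mathcomp Require Import zify ring lra.
Set Implicit Arguments.
Unset Strict Implicit.
Unset Printing Implicit Defensive.
Import Order.TTheory GRing.Theory Num.Theory.
Import numFieldNormedType.Exports.
Local Open Scope classical_set_scope.
Local Open Scope ring_scope.

(** Write [T z] for the last passage time to [z], [h z] for its mean, [g] for
    the shape function, [f q = g (1 - q, 1 + q)], and [beta] for
    [(kappa + 3) / (2 kappa + 3)], an exponent strictly between 1/2 and 1.

    A geodesic to [(n, n)] that passes through a vertex [v] far from the
    diagonal is too slow.  It splits at [v] into two paths, so that [T (n, n)]
    is at most the sum of two passage times, whose means are bounded by [g]
    ([mean_passage_time_le_shape], superadditivity).  As [g] is concave,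
    symmetric and homogeneous, the two values of [g] add up to at most
    [n g(1, 1)] minus a loss of order [n |q|^kappa], where [q] is the distance
    from [v] to the diagonal divided by [n] ([perp_gap_ge],
    [mean_passage_time_two_pieces]).  At a distance of order
    [n^((2 kappa + 2) / (2 kappa + 3))] the loss is of order [n^beta]
    ([displacement_le]), so it suffices that all errors are [O(n^beta)]; there
    are two kinds of them.

    Random errors.  A path has one vertex on each antidiagonal, so [T] is a
    function of [O(n)] independent blocks of weights, each of which moves it by
    at most 1.  McDiarmid's martingale argument, run block by block, bounds its
    exponential moments ([resample_triangle_expR]), and deviations of order
    [n^beta] at any of the [O(n^2)] vertices have probability at most
    [exp (-n^a)] for some [a > 0].

    The bias [n g(1, 1) - h (n, n)].  By symmetry, a path to [v] can be
    followed by the transpose of another path to [v], and the result ends on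
    the diagonal: [2 h v <= h (n, n)] for every [v] with [v.1 + v.2 = n].
    Conversely a path with [2 L] steps consists of two paths with [L] steps, so
    that the largest mean over [2 L] steps is at most twice the largest mean
    over [L] steps, up to [O(L^beta)] for the maximum over the splitting points
    ([mean_passage_time_doubling]).  Iterating the doubling from [n] to infinity
    gives [n g(1, 1) <= h (n, n) + O(n^beta)] ([shape_function_le_mean]).

    If [g] is not differentiable at [(1, 1)], then [kappa = 1] and [f] has a
    corner at 0: a concave symmetric [f] without a linear loss satisfies
    [f q = f 0 + o(q)], and homogeneity would make [g] differentiable. *)

(** * Directed paths and passage times *)

Definition level (v : vertex) : nat := (v.1 + v.2)%N.

Definition swap_vertex (v : vertex) : vertex := (v.2, v.1).

Definition add_vertex (u v : vertex) : vertex := (u.1 + v.1, u.2 + v.2)%N.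

Definition sub_vertex (u v : vertex) : vertex := (u.1 - v.1, u.2 - v.2)%N.

Definition shift_weight (z : vertex) (w : vertex -> bool) : vertex -> bool :=
  fun v => w (add_vertex z v).

Lemma add_vertex_inj z : injective (add_vertex z).
Proof. by move=> [a b] [c e] [/addnI -> /addnI ->]. Qed.

Lemma swap_vertex_inj : injective swap_vertex.
Proof. by move=> [a b] [c e] [-> ->]. Qed.

Lemma add_vertex0 z : add_vertex z (0, 0)%N = z.
Proof. by case: z => a b; rewrite /add_vertex /= !addn0. Qed.

Lemma add_vertexK v z : sub_vertex (add_vertex v z) v = z.
Proof. by rewrite /sub_vertex /= !addKn; case: z. Qed.

Lemma level_add u v : level (add_vertex u v) = (level u + level v)%N.
Proof. by rewrite /level /=; lia. Qed.

Lemma step_level u v : step u v -> level v = (level u).+1.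
Proof. by case/orP => /eqP ->; rewrite /level /= ?addSn ?addnS. Qed.

Lemma path_step_level u p :
  path step u p -> level (last u p) = (level u + size p)%N.
Proof.
elim: p u => [|x p IH] u /=; first by rewrite addn0.
by case/andP => /step_level e /IH ->; rewrite e addSnnS.
Qed.

Lemma directed_path_size z p : directed_path z p -> size p = level z.
Proof. by case/andP => /path_step_level + /eqP e; rewrite e. Qed.

Lemma count_level_path u p k :
  path step u p -> (count (fun v => level v == k) p <= (level u < k))%N.
Proof.
elim: p u => [|x p IH] u //= /andP[/step_level e /IH h].
by apply: leq_trans (leq_add (leqnn _) h) _; rewrite e; lia.
Qed.

Lemma step_add_vertex z u v : step (add_vertex z u) (add_vertex z v) = step u v.
Proof.
rewrite /step.
rewrite -[((add_vertex z u).1.+1, _)]/((z.1 + u.1).+1, (z.2 + u.2))%N.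
rewrite -[((add_vertex z u).1, _)]/(z.1 + u.1, (z.2 + u.2).+1)%N.
rewrite -!addnS -[X in _ == X]/(add_vertex z (u.1.+1, u.2)).
rewrite -[X in _ || (_ == X)]/(add_vertex z (u.1, u.2.+1)).
by rewrite !(inj_eq (@add_vertex_inj z)).
Qed.

Lemma path_add_vertex z u p :
  path step (add_vertex z u) (map (add_vertex z) p) = path step u p.
Proof. by elim: p u => [|x p IH] u //=; rewrite IH step_add_vertex. Qed.

Lemma path_swap_vertex u p :
  path step (swap_vertex u) (map swap_vertex p) = path step u p.
Proof.
elim: p u => [|x p IH] u //=; rewrite IH; congr (_ && _).
rewrite /step orbC -[X in _ == X]/(swap_vertex (u.1.+1, u.2)).
rewrite -[X in _ || (_ == X)]/(swap_vertex (u.1, u.2.+1)).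
by rewrite !(inj_eq swap_vertex_inj).
Qed.

Lemma path_unshift z u p : path step (add_vertex z u) p ->
  exists2 q, p = map (add_vertex z) q & path step u q.
Proof.
elim: p u => [|x p IH] u /=; first by exists [::].
case/andP => hs hp.
have [u' eu] : exists u', x = add_vertex z u'.
  case/orP: hs => /eqP ->.
    by exists (u.1.+1, u.2); rewrite /add_vertex /= addnS.
  by exists (u.1, u.2.+1); rewrite /add_vertex /= addnS.
rewrite {x}eu step_add_vertex in hs hp *.
have [q -> hq] := IH _ hp.
by exists (u' :: q) => //=; rewrite hs.
Qed.

Lemma last_map_from (f : vertex -> vertex) u p :
  last (f u) (map f p) = f (last u p).
Proof. by elim: p u => //=. Qed.

Lemma passage_time_cat (w : vertex -> bool) p q :
  passage_time w (p ++ q) = (passage_time w p + passage_time w q)%N.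
Proof. by rewrite /passage_time big_cat. Qed.

Lemma passage_time_shift (w : vertex -> bool) z p :
  passage_time w (map (add_vertex z) p) = passage_time (shift_weight z w) p.
Proof. by rewrite /passage_time big_map. Qed.

Lemma passage_time_le_size (w : vertex -> bool) p :
  (passage_time w p <= size p)%N.
Proof.
rewrite /passage_time -sum1_size; apply: leq_sum => v _; exact: leq_b1.
Qed.

Lemma directed_path_cat z z' p q : directed_path z p -> directed_path z' q ->
  directed_path (add_vertex z z') (p ++ map (add_vertex z) q).
Proof.
case/andP => hp /eqP lp /andP[hq /eqP lq].
rewrite /directed_path cat_path hp last_cat lp.
have ez := add_vertex0 z.
have -> : path step z (map (add_vertex z) q) by rewrite -{1}ez path_add_vertex.
by rewrite -{1}ez last_map_from lq eqxx.
Qed.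

Lemma directed_path_split z p v : directed_path z p -> v \in (0, 0)%N :: p ->
  exists p1 p2 z', [/\ p = p1 ++ map (add_vertex v) p2, directed_path v p1,
    directed_path z' p2 & z = add_vertex v z'].
Proof.
move=> /andP[hp /eqP lp] vp.
case/splitPl: vp hp lp => p1 p2 lp1.
rewrite cat_path last_cat lp1 => /andP[hp1 hp2] lp2.
have := hp2; rewrite -{1}(add_vertex0 v) => /path_unshift[q e hq].
exists p1, q, (last (0, 0)%N q); split.
- by rewrite e.
- by rewrite /directed_path hp1 lp1 eqxx.
- by rewrite /directed_path hq eqxx.
- by rewrite -lp2 e -{1}(add_vertex0 v) last_map_from.
Qed.

Lemma directed_path_le z p v : directed_path z p -> v \in p ->
  (v.1 <= z.1)%N /\ (v.2 <= z.2)%N.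
Proof.
move=> hp vp.
have [|p1 [p2 [z' [_ _ _ ->]]]] := directed_path_split (v := v) hp.
  by rewrite inE vp orbT.
by rewrite /= !leq_addr.
Qed.

Lemma directed_path_level_vertex z p k :
  directed_path z p -> (k <= level z)%N ->
  exists2 v, v \in (0, 0)%N :: p & level v = k.
Proof.
move=> hp kz; have sp := directed_path_size hp.
case/andP: hp => hp _.
exists (last (0, 0)%N (take k p)).
  have: last (0, 0)%N (take k p) \in (0, 0)%N :: take k p by exact: mem_last.
  by rewrite !inE => /orP[-> //|/mem_take ->]; rewrite orbT.
rewrite path_step_level ?take_path // size_takel ?sp //.
Qed.

(** ** The last passage time as a function of the weights *)

Lemma last_passage_time_attained (w : vertex -> bool) z :
  exists2 p, directed_path z p & last_passage_time w z = passage_time w p.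
Proof.
have [p /andP[hp /eqP e]] := geodesic_exists w z; by exists p.
Qed.

Lemma last_passage_time_le_level (w : vertex -> bool) z :
  (last_passage_time w z <= level z)%N.
Proof.
have [p /directed_path_size <- ->] := last_passage_time_attained w z.
exact: passage_time_le_size.
Qed.

Lemma last_passage_time_superadditive (w : vertex -> bool) z z' :
  (last_passage_time w z + last_passage_time (shift_weight z w) z'
   <= last_passage_time w (add_vertex z z'))%N.
Proof.
have [p hp ->] := last_passage_time_attained w z.
have [q hq ->] := last_passage_time_attained (shift_weight z w) z'.
rewrite -passage_time_shift -passage_time_cat.
exact/last_passage_time_ge/directed_path_cat.
Qed.

(** Cut at [v], the path gives two competitors, one for the passage time to [v]
    and one for the passage time from [v]. *)
Lemma passage_time_le_through (w : vertex -> bool) z p v :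
  directed_path z p -> v \in (0, 0)%N :: p ->
  exists2 z', z = add_vertex v z' &
    (passage_time w p <= last_passage_time w v
       + last_passage_time (shift_weight v w) z')%N.
Proof.
move=> hp vp; have [p1 [p2 [z' [-> h1 h2 ->]]]] := directed_path_split hp vp.
exists z' => //; rewrite passage_time_cat passage_time_shift.
by apply: leq_add; exact: last_passage_time_ge.
Qed.

Lemma last_passage_time_swap (w : vertex -> bool) z :
  last_passage_time (w \o swap_vertex) z = last_passage_time w (swap_vertex z).
Proof.
have half w' z' : (last_passage_time (w' \o swap_vertex) z'
                   <= last_passage_time w' (swap_vertex z'))%N.
  have [p hp ->] := last_passage_time_attained (w' \o swap_vertex) z'.
  have -> : passage_time (w' \o swap_vertex) p
            = passage_time w' (map swap_vertex p).
    by rewrite /passage_time big_map.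
  apply: last_passage_time_ge; case/andP: hp => hp /eqP e.
  rewrite /directed_path -[(0, 0)%N]/(swap_vertex (0, 0)%N).
  by rewrite path_swap_vertex hp last_map_from e eqxx.
apply/eqP; rewrite eqn_leq half /=.
have := half (w \o swap_vertex) (swap_vertex z).
have -> : (w \o swap_vertex) \o swap_vertex = w by apply: funext => -[].
by case: z.
Qed.

Lemma eq_passage_time (w w' : vertex -> bool) p :
  (forall v, v \in p -> w v = w' v) -> passage_time w p = passage_time w' p.
Proof.
move=> e; rewrite /passage_time big_seq [RHS]big_seq.
by apply: eq_bigr => v /e ->.
Qed.

Lemma eq_last_passage_time (w w' : vertex -> bool) z :
  (forall v, (v.1 <= z.1)%N -> (v.2 <= z.2)%N -> w v = w' v) ->
  last_passage_time w z = last_passage_time w' z.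
Proof.
have half w1 w2 : (forall v, (v.1 <= z.1)%N -> (v.2 <= z.2)%N -> w1 v = w2 v) ->
    (last_passage_time w1 z <= last_passage_time w2 z)%N.
  move=> e; have [p hp ->] := last_passage_time_attained w1 z.
  rewrite (eq_passage_time (w' := w2)) ?last_passage_time_ge // => v.
  by move=> /(directed_path_le hp)[]; exact: e.
move=> e; apply/eqP; rewrite eqn_leq !half // => v h1 h2.
by rewrite e.
Qed.

(** A directed path meets each antidiagonal at most once, so that resampling a
    whole antidiagonal moves the last passage time by at most one. *)
Lemma last_passage_time_level_lipschitz (w w' : vertex -> bool) z k :
  (forall v, level v != k -> w v = w' v) ->
  (last_passage_time w z <= (last_passage_time w' z).+1)%N.
Proof.
move=> e; have [p hp ->] := last_passage_time_attained w z.
apply: leq_trans (_ : passage_time w' p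
                      + count (fun v => level v == k) p <= _)%N.
  rewrite -sum1_count big_mkcond /passage_time -big_split /=.
  apply: leq_sum => v _; case: eqP => [_|/eqP /e ->]; last by rewrite addn0.
  by rewrite addn1; case: (w v).
rewrite -addn1; apply: leq_add; first exact: last_passage_time_ge.
case/andP: hp => /(count_level_path k) h _; apply: leq_trans h _; exact: leq_b1.
Qed.

(** * Averaging independent Bernoulli weights one at a time *)

Definition set_weight (w : vertex -> bool) (v : vertex) (b : bool) :
    vertex -> bool := fun u => if u == v then b else w u.

(** Coordinates outside [l] are read from [w].  Keeping the result a function of
    [w] makes averaging over [l1 ++ l2] a composition, which is what the
    induction over antidiagonals needs. *)
Fixpoint resample (R : realType) (s : R) (l : seq vertex)
    (F : (vertex -> bool) -> R) (w : vertex -> bool) : R :=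
  if l is v :: l' then
    s * resample s l' F (set_weight w v true)
    + (1 - s) * resample s l' F (set_weight w v false)
  else F w.

Definition agree_off (l : seq vertex) (w w' : vertex -> bool) : Prop :=
  forall v, v \notin l -> w v = w' v.

Lemma agree_off_set_weight l w v b : agree_off (v :: l) (set_weight w v b) w.
Proof. by move=> u; rewrite inE negb_or /set_weight => /andP[/negPf ->]. Qed.

Section Resample.
Variables (R : realType) (s : R).
Implicit Types (l : seq vertex) (F G : (vertex -> bool) -> R).
Implicit Types (w : vertex -> bool).

Lemma resample_cat l1 l2 F w :
  resample s (l1 ++ l2) F w = resample s l1 (resample s l2 F) w.
Proof. by elim: l1 w => [|v l1 IH] w //=; rewrite !IH. Qed.

Lemma resample_cst l c w : resample s l (fun=> c) w = c.
Proof. by elim: l w => [|v l IH] w //=; rewrite !IH; ring. Qed.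

Lemma resampleD l F G w :
  resample s l (fun w' => F w' + G w') w = resample s l F w + resample s l G w.
Proof. by elim: l w => [|v l IH] w //=; rewrite !IH; ring. Qed.

Lemma resampleZ l c F w :
  resample s l (fun w' => c * F w') w = c * resample s l F w.
Proof. by elim: l w => [|v l IH] w //=; rewrite !IH; ring. Qed.

Lemma resample_sum (I : Type) (r : seq I) (Q : pred I)
    (F : I -> (vertex -> bool) -> R) l w :
  resample s l (fun w' => \sum_(i <- r | Q i) F i w') w
  = \sum_(i <- r | Q i) resample s l (F i) w.
Proof.
elim: l w => [|v l IH] w //=; rewrite !IH.
by rewrite !mulr_sumr -big_split.
Qed.

(** Serves for the translations and for the transposition of the grid. *)
Lemma resample_reindex (f : vertex -> vertex) l F w : injective f ->
  resample s (map f l) (fun w' => F (w' \o f)) w = resample s l F (w \o f).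
Proof.
move=> fI; elim: l w => [|v l IH] w //=; rewrite !IH.
have e b : set_weight w (f v) b \o f = set_weight (w \o f) v b.
  by apply: funext => u; rewrite /set_weight /= (inj_eq fI).
by rewrite !e.
Qed.

Hypotheses (s_ge0 : 0 <= s) (s_le1 : s <= 1).

Lemma resample_le l F G w :
  (forall w', agree_off l w' w -> F w' <= G w') ->
  resample s l F w <= resample s l G w.
Proof.
elim: l w => [|v l IH] w FG /=; first exact: FG.
have h b w' : agree_off l w' (set_weight w v b) -> F w' <= G w'.
  move=> w'w; apply: FG => u ul; rewrite -(agree_off_set_weight w b ul).
  by apply: w'w; move: ul; rewrite inE negb_or => /andP[].
by apply: lerD; apply: ler_wpM2l; rewrite ?subr_ge0 //; apply: IH => w' /h.
Qed.

Lemma resample_le_cst l F w b :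
  (forall w', agree_off l w' w -> F w' <= b) -> resample s l F w <= b.
Proof. by move=> h; rewrite -(resample_cst l b w); exact: resample_le. Qed.

Lemma resample_ge_cst l F w a :
  (forall w', agree_off l w' w -> a <= F w') -> a <= resample s l F w.
Proof. by move=> h; rewrite -(resample_cst l a w); exact: resample_le. Qed.

(** The two configurations are coupled by giving them the same new weights. *)
Lemma resample_coupling l l' F G w w' : agree_off l' w w' ->
  (forall u u', agree_off l' u u' -> F u <= G u') ->
  resample s l F w <= resample s l G w'.
Proof.
move=> + FG; elim: l w w' => [|v l IH] w w' ww' /=; first exact: FG.
have a b : agree_off l' (set_weight w v b) (set_weight w' v b).
  by move=> u /ww'; rewrite /set_weight; case: eqP.
by apply: lerD; apply: ler_wpM2l; rewrite ?subr_ge0 //; apply: IH.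
Qed.

Lemma expR_le_quadratic (x : R) : `|x| <= 1 / 2 -> expR x <= 1 + x + 2 * x ^+ 2.
Proof.
rewrite ler_norml => /andP[xl xr].
have x1 : 0 < 1 - x by lra.
have h : expR x <= (1 - x)^-1.
  rewrite -[x in expR x]opprK expRN lef_pV2 ?posrE ?expR_gt0 //.
  by have := expR_ge1Dx (- x); rewrite addrC.
apply: le_trans h _; rewrite -[X in X <= _]mul1r ler_pdivrMr //.
have -> : (1 + x + 2 * x ^+ 2) * (1 - x) = 1 + x ^+ 2 * (1 - 2 * x) by ring.
by rewrite lerDl mulr_ge0 ?sqr_ge0 //; lra.
Qed.

(** While the block is resampled [F] stays within [1] of its average, so the
    exponential is bounded by its quadratic expansion, whose linear term
    averages out. *)
Lemma resample_expR_block l F w (lam : R) : `|lam| <= 1 / 2 ->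
  (forall u u', agree_off l u u' -> F u <= F u' + 1) ->
  resample s l (fun w' => expR (lam * F w')) w
  <= expR (lam * resample s l F w + 2 * lam ^+ 2).
Proof.
move=> laml Fl; set m := resample s l F w.
have Fm w' : agree_off l w' w -> `|F w' - m| <= 1.
  move=> w'w; rewrite ler_norml; apply/andP; split.
    rewrite lerBrDr addrC -lerBrDr opprK; apply: resample_le_cst => u uw.
    by apply: Fl => v vl; rewrite uw ?w'w.
  rewrite lerBlDr addrC -lerBlDr; apply: resample_ge_cst => u uw.
  by rewrite lerBlDr; apply: Fl => v vl; rewrite uw ?w'w.
pose G w' := expR (lam * m) * (1 + 2 * lam ^+ 2 - lam * m + lam * F w').
apply: le_trans (_ : resample s l G w <= _).
  apply: resample_le => w' w'w.
  have -> : lam * F w' = lam * m + lam * (F w' - m) by ring.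
  rewrite expRD /G ler_wpM2l ?expR_ge0 //.
  have h := Fm _ w'w.
  have hx : `|lam * (F w' - m)| <= 1 / 2.
    by rewrite normrM -[1 / 2]mulr1 ler_pM.
  apply: le_trans (expR_le_quadratic hx) _.
  rewrite exprMn.
  have h2 : (F w' - m) ^+ 2 <= 1 by rewrite -real_normK ?num_real // expr_le1.
  have := ler_wpM2l (sqr_ge0 lam) h2; lra.
rewrite /G resampleZ resampleD resample_cst resampleZ -/m expRD.
rewrite ler_wpM2l ?expR_ge0 //.
apply: le_trans (expR_ge1Dx _); lra.
Qed.

End Resample.

(** ** Triangles, enumerated by antidiagonals *)

Definition antidiagonal (k : nat) : seq vertex :=
  [seq (i, (k - i)%N) | i <- iota 0 k.+1].

Fixpoint triangle (N : nat) : seq vertex :=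
  if N is N'.+1 then triangle N' ++ antidiagonal N' else [::].

Arguments antidiagonal : simpl never.
Arguments triangle : simpl never.

Lemma mem_antidiagonal k v : (v \in antidiagonal k) = (level v == k).
Proof.
apply/mapP/eqP => [[i]|<-].
  by rewrite mem_iota add0n ltnS => /andP[_ h] ->; rewrite /level /= subnKC.
exists v.1; first by rewrite mem_iota add0n ltnS; apply: leq_addr.
by case: v => a b; rewrite /level /= addKn.
Qed.

Lemma triangleS N : triangle N.+1 = triangle N ++ antidiagonal N.
Proof. by []. Qed.

Lemma mem_triangle N v : (v \in triangle N) = (level v < N)%N.
Proof.
elim: N => [|N IH] //.
by rewrite triangleS mem_cat IH mem_antidiagonal ltnS [RHS]leq_eqVlt orbC.
Qed.

Lemma triangle_uniq N : uniq (triangle N).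
Proof.
elim: N => [|N IH] //; rewrite triangleS cat_uniq IH; apply/andP; split=> //.
apply/andP; split.
  apply/hasPn => v; rewrite mem_antidiagonal => /eqP e.
  by rewrite -[X in ~~ X]/(v \in triangle N) mem_triangle e ltnn.
by rewrite map_inj_uniq ?iota_uniq // => i j [].
Qed.

(** McDiarmid's inequality in exponential form, antidiagonal by antidiagonal:
    there are only [N] blocks although there are of order [N^2] weights. *)
Lemma resample_triangle_expR (R : realType) (s : R) N
    (F : (vertex -> bool) -> R) w (lam : R) :
  0 <= s -> s <= 1 -> `|lam| <= 1 / 2 ->
  (forall k u u', agree_off (antidiagonal k) u u' -> F u <= F u' + 1) ->
  resample s (triangle N) (fun w' => expR (lam * F w')) w
  <= expR (lam * resample s (triangle N) F w + 2 * lam ^+ 2 * N%:R).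
Proof.
move=> s0 s1 laml; elim: N F => [|N IH] F Fl; first by rewrite mulr0 addr0.
rewrite triangleS !resample_cat; set G := resample s (antidiagonal N) F.
apply: le_trans (_ : resample s (triangle N)
   (fun w' => expR (2 * lam ^+ 2) * expR (lam * G w')) w <= _).
  apply: resample_le => // w' _; rewrite -expRD addrC.
  by apply: resample_expR_block => //; exact: Fl.
have Gl k u u' : agree_off (antidiagonal k) u u' -> G u <= G u' + 1.
  move=> uu'; rewrite /G.
  rewrite -[X in _ <= _ + X](resample_cst s (antidiagonal N) 1 u').
  by rewrite -resampleD; apply: (resample_coupling s0 s1 _ uu'); exact: Fl.
rewrite resampleZ; apply: le_trans (ler_wpM2l (expR_ge0 _) (IH _ Gl)) _.
by rewrite -expRD ler_expR -natr1 -/G; lra.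
Qed.

(** * From the probability space to finite averages *)

Definition determined_by (l : seq vertex) (U : Type)
    (F : (vertex -> bool) -> U) : Prop :=
  forall u u', (forall v, v \in l -> u v = u' v) -> F u = F u'.

Section Transfer.
Variables (R : realType) (d : measure_display) (T : measurableType d).
Variables (P : probability T R) (s : R) (w : vertex -> {RV P >-> bool}).
Hypothesis w_iid : iid_bernoulli w s.
Implicit Types (l J : seq vertex) (u : vertex -> bool).

Let prescribed J u : set T := [set t | forall v, v \in J -> w v t = u v].

Let prescribedE J u :
  prescribed J u = \bigcap_(v in [set` J]) (w v @^-1` [set u v]).
Proof. by apply/seteqP; split => t h v vJ; exact: h. Qed.

Let measurable_weight v (B : set bool) : measurable (w v @^-1` B).
Proof. by rewrite -[X in measurable X]setTI; exact: measurable_funPT. Qed.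

Let measurable_prescribed J u : measurable (prescribed J u).
Proof. by rewrite prescribedE; apply: fin_bigcap_measurable. Qed.

Let prob_weight v b : P (w v @^-1` [set b]) = (if b then s else 1 - s)%:E.
Proof.
have [_ wt] := w_iid; case: b; first exact: wt.
have -> : w v @^-1` [set false] = ~` (w v @^-1` [set true]).
  by apply/seteqP; split => t /=; case: (w v t).
by rewrite probability_setC // wt.
Qed.

Let prob_prescribed J u : uniq J ->
  P (prescribed J u) = (\prod_(v <- J) if u v then s else 1 - s)%:E.
Proof.
move=> uJ; rewrite prescribedE; case: w_iid => ind _.
rewrite (ind J (fun v => [set u v])) // -prodEFin.
by apply: eq_bigr => v _; rewrite prob_weight.
Qed.

Let prescribed_cons J u v b : v \notin J ->
  prescribed (v :: J) (set_weight u v b) =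
  prescribed J u `&` (w v @^-1` [set b]).
Proof.
move=> vJ; apply/seteqP; split => t /=.
  move=> h; split; last by rewrite h ?mem_head // /set_weight eqxx.
  move=> x xJ; rewrite h ?inE ?xJ ?orbT // /set_weight.
  by case: eqP => // xv; rewrite -xv xJ in vJ.
case=> h1 h2 x; rewrite inE /set_weight; case: eqP => [-> //|_ /=].
exact: h1.
Qed.

Let prescribed_split J u v : v \notin J ->
  prescribed J u = prescribed (v :: J) (set_weight u v true)
               `|` prescribed (v :: J) (set_weight u v false).
Proof.
move=> vJ; rewrite !prescribed_cons // -setIUr.
have -> : w v @^-1` [set true] `|` w v @^-1` [set false] = setT.
  by apply/seteqP; split => // t _ /=; case: (w v t); [left|right].
by rewrite setIT.
Qed.

(** Conditioning on the weights in [J], the vertices of [l] are revealed one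
    after the other; both claims go through the same case distinction on the
    next weight. *)
Let integral_prescribed l J u (F : (vertex -> bool) -> R) :
  uniq (l ++ J) -> (forall w', 0 <= F w') -> determined_by (l ++ J) F ->
  measurable_fun (prescribed J u) (fun t => F (fun v => w v t) : R) /\
  (\int[P]_(t in prescribed J u) (F (fun v => w v t))%:E
   = P (prescribed J u) * (resample s l F u)%:E)%E.
Proof.
move=> + F0; elim: l J u => [|v l IH] J u /=.
  move=> uJ dF.
  have e : {in prescribed J u, (fun=> F u) =1 (fun t => F (fun v => w v t))}.
    by move=> t /set_mem ht; apply: dF => v vJ; rewrite ht.
  split; first by apply: eq_measurable_fun e _; exact: measurable_cst.
  under eq_integral => t tJ do rewrite -(e t tJ).
  by rewrite (integral_cst _ (measurable_prescribed _ _)) muleC.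
move=> /andP[+ ulJ] dF.
rewrite mem_cat negb_or => /andP[vl vJ].
have u2 : uniq (l ++ (v :: J)).
  by rewrite uniq_catC /= mem_cat negb_or vJ vl uniq_catC.
have dF2 : determined_by (l ++ v :: J) F.
  move=> w1 w2 h; apply: dF => x; rewrite -cat_cons => hx; apply: h.
  by move: hx; rewrite !mem_cat !inE; case: (x == v); rewrite ?orbT.
have [m1 i1] := IH (v :: J) (set_weight u v true) u2 dF2.
have [m2 i2] := IH (v :: J) (set_weight u v false) u2 dF2.
rewrite (prescribed_split u vJ).
have mU : measurable_fun (prescribed (v :: J) (set_weight u v true)
    `|` prescribed (v :: J) (set_weight u v false))
   (fun t => F (fun v => w v t) : R).
  by apply/measurable_funU.
split=> //.
rewrite ge0_integral_setU //; last 3 first.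
- exact/measurable_EFinP.
- by move=> t _; rewrite lee_fin.
- rewrite !prescribed_cons //; apply/disj_setPS => t /=.
  by move=> [[_ a] [_ b]]; rewrite a in b.
rewrite i1 i2 -(prescribed_split u vJ).
have uvJ : uniq (v :: J) by move: u2; rewrite cat_uniq => /and3P[].
have pJ b : P (prescribed (v :: J) (set_weight u v b))
            = ((if b then s else 1 - s)%:E * P (prescribed J u))%E.
  rewrite !prob_prescribed //; last by case/andP: uvJ.
  rewrite big_cons -EFinM /set_weight eqxx; congr (_ * _)%:E.
  rewrite big_seq [RHS]big_seq; apply: eq_bigr => x xJ.
  by case: eqP => // xv; rewrite -xv xJ in vJ.
rewrite !pJ (prob_prescribed _ (J := J)); last by case/andP: uvJ.
by rewrite -!EFinM -EFinD; congr (_%:E); ring.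
Qed.

Lemma measurable_fun_weights l (F : (vertex -> bool) -> R) :
  uniq l -> (forall u, 0 <= F u) -> determined_by l F ->
  measurable_fun setT (fun t => F (fun v => w v t) : R).
Proof.
move=> ul F0 dF.
have := @integral_prescribed l [::] xpredT F; rewrite cats0 => /(_ ul F0 dF)[].
have -> // : prescribed [::] xpredT = setT by apply/seteqP; split => // t _ v.
Qed.

Lemma expectation_weights l (F : (vertex -> bool) -> R) u :
  uniq l -> (forall u, 0 <= F u) -> determined_by l F ->
  ('E_P[fun t => F (fun v => w v t)] = (resample s l F u)%:E)%E.
Proof.
move=> ul F0 dF; rewrite unlock.
have := @integral_prescribed l [::] u F; rewrite cats0 => /(_ ul F0 dF)[_].
have -> : prescribed [::] u = setT by apply/seteqP; split => // t _ v.
by rewrite probability_setT mul1e.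
Qed.

Lemma probability_weights l (A : pred (vertex -> bool)) u :
  uniq l -> determined_by l A ->
  P [set t | A (fun v => w v t)] = (resample s l (fun u' => (A u')%:R) u)%:E.
Proof.
move=> ul dA; pose F u' : R := (A u')%:R.
have F0 u' : 0 <= F u' by rewrite ler0n.
have dF : determined_by l F by move=> u1 u2 /dA e; rewrite /F e.
rewrite -(expectation_weights u ul F0 dF).
have mA : measurable [set t | A (fun v => w v t)].
  have := measurable_fun_weights ul F0 dF measurableT (measurable_set1 1).
  rewrite setTI; congr measurable; apply/seteqP; split => t /=; rewrite /F.
    by case: (A _) => //= /eqP; rewrite eq_sym oner_eq0.
  by move=> ->.
rewrite -(expectation_indic P mA); congr (expectation _ _); apply: funext => t.
rewrite indicE /F; congr (_%:R); congr nat_of_bool.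
by apply/idP/idP => [/set_mem//|h]; rewrite inE.
Qed.

End Transfer.

(** * The mean passage time *)

Section MeanPassageTime.
Variables (R : realType) (d : measure_display) (T : measurableType d).
Variables (P : probability T R) (s : R) (w : vertex -> {RV P >-> bool}).
Hypotheses (w_iid : iid_bernoulli w s) (s_ge0 : 0 <= s) (s_le1 : s <= 1).
Implicit Types (z : vertex) (u : vertex -> bool).

Let h : vertex -> R := mean_passage_time w.

(** The left average is an expectation, hence does not depend on the list as
    long as the list determines the integrand; over [map f l'] it becomes the
    right one by relabelling. *)
Lemma resample_reindex_determined l l' (f : vertex -> vertex)
    (F : (vertex -> bool) -> R) u u' :
  injective f -> uniq l -> uniq l' -> (forall x, 0 <= F x) ->
  determined_by l' F -> {subset map f l' <= l} ->
  resample s l (fun x => F (x \o f)) u = resample s l' F u'.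
Proof.
move=> fI ul ul' F0 dF ll'.
pose G x := F (x \o f).
have G0 x : 0 <= G x by exact: F0.
have dG : determined_by (map f l') G.
  by move=> x y xy; apply: dF => v vl; apply: xy; exact: map_f.
have dG2 : determined_by l G by move=> x y xy; apply: dG => v /ll' /xy.
have e1 := expectation_weights w_iid u ul G0 dG2.
have u2 : uniq (map f l') by rewrite map_inj_uniq.
have := expectation_weights w_iid (fun=> true) u2 G0 dG.
rewrite e1 resample_reindex // => -[->].
have e3 x := expectation_weights w_iid x ul' F0 dF.
by have := e3 u'; rewrite (e3 ((fun=> true) \o f)) => -[].
Qed.

Lemma last_passage_time_determined z N : (level z < N)%N ->
  determined_by (triangle N) (fun u => last_passage_time u z).
Proof.
move=> zN x y xy; apply: eq_last_passage_time => v v1 v2.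
apply: xy; rewrite mem_triangle; apply: leq_ltn_trans zN.
exact: leq_add.
Qed.

Lemma shift_weight0 u : shift_weight (0, 0)%N u = u.
Proof. by apply: funext => -[a b]. Qed.

Lemma mean_passage_timeE z z' N u : (level z + level z' < N)%N ->
  h z' = resample s (triangle N)
           (fun x => (last_passage_time (shift_weight z x) z')%:R) u.
Proof.
move=> zN; pose F x : R := (last_passage_time x z')%:R.
have dF : determined_by (triangle (level z').+1) F.
  by move=> x y xy; rewrite /F (last_passage_time_determined _ xy).
have F0 x : 0 <= F x by exact: ler0n.
rewrite /h /mean_passage_time.
have -> := expectation_weights w_iid u (triangle_uniq _) F0 dF.
rewrite [fine _]/=.
rewrite -(@resample_reindex_determined (triangle N) _ (add_vertex z) F u) //.
- exact: add_vertex_inj.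
- exact: triangle_uniq.
- exact: triangle_uniq.
- move=> _ /mapP[v + ->]; rewrite !mem_triangle level_add.
  by move: zN; clear; lia.
Qed.

Lemma mean_passage_timeE0 z N u : (level z < N)%N ->
  h z = resample s (triangle N) (fun x => (last_passage_time x z)%:R) u.
Proof.
move=> zN; rewrite (@mean_passage_timeE (0, 0)%N z N u) //.
by congr resample; apply: funext => x; rewrite shift_weight0.
Qed.

Lemma mean_passage_time_ge0 z : 0 <= h z.
Proof.
rewrite (mean_passage_timeE0 (fun=> true) (ltnSn _)).
by apply: resample_ge_cst => // x _; exact: ler0n.
Qed.

Lemma mean_passage_time_le_level z : h z <= (level z)%:R.
Proof.
rewrite (mean_passage_timeE0 (fun=> true) (ltnSn _)).
apply: resample_le_cst => // x _; rewrite ler_nat.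
exact: last_passage_time_le_level.
Qed.

Lemma mean_passage_time_superadditive z z' :
  h z + h z' <= h (add_vertex z z').
Proof.
pose N := (level (add_vertex z z')).+1; pose u : vertex -> bool := fun=> true.
rewrite (@mean_passage_timeE0 z N u) ?(@mean_passage_timeE z z' N u)
        ?(@mean_passage_timeE0 (add_vertex z z') N u)
        ?/N ?level_add ?ltnS ?leq_addr //.
rewrite -resampleD; apply: resample_le => // x _.
by rewrite -natrD ler_nat; exact: last_passage_time_superadditive.
Qed.

Lemma mean_passage_time_le z z' :
  (z.1 <= z'.1)%N -> (z.2 <= z'.2)%N -> h z <= h z'.
Proof.
move=> h1 h2.
have -> : z' = add_vertex z (z'.1 - z.1, z'.2 - z.2)%N.
  by rewrite /add_vertex /= !subnKC //; case: (z').
apply: le_trans (mean_passage_time_superadditive _ _).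
by rewrite lerDl mean_passage_time_ge0.
Qed.

Lemma mean_passage_time_swap z : h (swap_vertex z) = h z.
Proof.
pose N := (level z).+1; pose u : vertex -> bool := fun=> true.
have lz : level (swap_vertex z) = level z by rewrite /level addnC.
rewrite (@mean_passage_timeE0 z N u) // (@mean_passage_timeE0 _ N u) ?lz //.
pose F x : R := (last_passage_time x z)%:R.
rewrite -(@resample_reindex_determined (triangle N) _ swap_vertex F u u) //.
- congr resample; apply: funext => x.
  by rewrite /F last_passage_time_swap.
- exact: swap_vertex_inj.
- exact: triangle_uniq.
- exact: triangle_uniq.
- by move=> x y xy; rewrite /F (last_passage_time_determined _ xy).
- by move=> _ /mapP[v + ->]; rewrite !mem_triangle /level addnC.
Qed.

Lemma exponential_moment_passage_time z z' N u (lam : R) :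
  (level z + level z' < N)%N -> `|lam| <= 1 / 2 ->
  resample s (triangle N) (fun x => expR (lam *
     ((last_passage_time (shift_weight z x) z')%:R - h z'))) u
  <= expR (2 * lam ^+ 2 * N%:R).
Proof.
move=> zN laml.
pose F x : R := (last_passage_time (shift_weight z x) z')%:R - h z'.
apply: le_trans (@resample_triangle_expR _ s N F u lam s_ge0 s_le1 laml _) _.
  move=> k x y xy; rewrite /F addrAC lerD2r natr1 ler_nat.
  apply: (@last_passage_time_level_lipschitz _ _ _ (k - level z)%N) => v vk.
  apply: xy; rewrite mem_antidiagonal level_add; move: vk; lia.
rewrite ler_expR.
have -> : resample s (triangle N) F u = 0; last by rewrite mulr0 add0r.
by rewrite resampleD -mean_passage_timeE // resample_cst subrr.
Qed.

End MeanPassageTime.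

(** * Superadditivity and the shape function *)

Section Fekete.
Variables (R : realType) (a : nat -> R).
Hypotheses (a_ge0 : forall n, 0 <= a n)
  (a_superadditive : forall m n, a m + a n <= a (m + n)%N).

Let a_nondecreasing m n : (m <= n)%N -> a m <= a n.
Proof.
move=> mn; rewrite -(subnKC mn); apply: le_trans (a_superadditive _ _).
by rewrite lerDl.
Qed.

Let a_mul q m : q%:R * a m <= a (q * m)%N.
Proof.
elim: q => [|q IH]; first by rewrite mul0r.
rewrite -natr1 mulrDl mul1r mulSn addnC.
by apply: le_trans (a_superadditive _ _); rewrite lerD2r.
Qed.

(** Fekete's lemma.  The limit is the supremum of the quotients: dividing [n] by
    an index [m] with [a m / m] almost extremal, the remainder costs a bounded
    amount. *)
Lemma superadditive_limit (B : R) : (forall n, a n <= B * n%:R) ->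
  exists2 L, a n / n%:R @[n --> \oo] --> (L : R^o) & forall n, a n <= L * n%:R.
Proof.
move=> aB; pose E : set R := [set a n.+1 / n.+1%:R | n in [set: nat]].
have ubE : ubound E B.
  by move=> _ [n _ <-]; rewrite ler_pdivrMr ?ltr0n.
have supE : has_sup E by split; [exists (a 1 / 1), 0%N | exists B].
have leL n : a n <= sup E * n%:R.
  case: n => [|n]; first by have := aB 0%N; rewrite !mulr0.
  by rewrite -ler_pdivrMr ?ltr0n //; apply: ub_le_sup; [exists B | exists n].
exists (sup E) => //; set L := sup E in leL *.
have L0 : 0 <= L by have := leL 1%N; rewrite mulr1; exact: le_trans.
apply/cvgrPdist_le => e e0.
have e2 : 0 < e / 2 by rewrite divr_gt0.
have [_ [m' _ <-] mL] := sup_adherent e2 supE.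
set m := m'.+1 in mL; set r := a m / m%:R in mL.
have m0 : 0 < m%:R :> R by rewrite ltr0n.
have rm : r * m%:R = a m by rewrite /r divfK // gt_eqF.
have r0 : 0 <= r by rewrite /r divr_ge0 // ltW.
have rL : r <= L by rewrite /r ler_pdivrMr.
near=> n.
have n0 : (0 < n)%N by near: n; exact: nbhs_infty_gt.
have n0R : 0 < n%:R :> R by rewrite ltr0n.
have hn : 2 * m%:R * L / e <= n%:R by near: n; exact: nbhs_infty_ger.
have anL : a n / n%:R <= L by rewrite ler_pdivrMr.
suff : L - e <= a n / n%:R by rewrite ler_norml; lra.
rewrite ler_pdivlMr //.
have h1 : (n %/ m)%:R * a m <= a n.
  apply: le_trans (a_mul _ _) _; apply: a_nondecreasing.
  exact: leq_trunc_div.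
apply: le_trans h1; rewrite -rm mulrCA mulrA.
have h2 : n%:R <= (n %/ m)%:R * m%:R + m%:R :> R.
  rewrite -natrM -natrD ler_nat {1}(divn_eq n m) leq_add2l ltnW //.
  by rewrite ltn_mod.
have h3 : 2 * m%:R * L <= n%:R * e by rewrite -ler_pdivrMr.
have h4 := ler_wpM2l r0 h2.
have h5 : r * m%:R <= L * m%:R by rewrite ler_pM2r.
have h6 : (L - e / 2) * n%:R <= r * n%:R by rewrite ler_pM2r // ltW.
rewrite mulrDl mulNr; rewrite mulrDl mulNr in h6; lra.
Unshelve. all: by end_near.
Qed.

End Fekete.

(** The doubling argument below controls the means only along [n, 2 n, 4 n] and
    so on. *)
Lemma limit_le_unbounded (R : realType) (a : nat -> R) (L c : R)
    (N : nat -> nat) :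
  a n / n%:R @[n --> \oo] --> (L : R^o) -> (forall k, (k < N k)%N) ->
  (forall k, a (N k) <= c * (N k)%:R) -> L <= c.
Proof.
move=> aL kN aN; apply/ler_addgt0Pr => e e0.
move/cvgrPdist_le : aL => /(_ e e0) [M _ hM].
have := hM (N M) (ltnW (kN M)).
have N0 : 0 < (N M)%:R :> R by rewrite ltr0n; apply: leq_ltn_trans (kN M).
rewrite ler_norml => /andP[_]; rewrite lerBlDl => h.
by apply: le_trans h _; rewrite lerD2r ler_pdivrMr.
Qed.

Section ShapeFunction.
Variables (R : realType) (d : measure_display) (T : measurableType d).
Variables (P : probability T R) (s : R) (w : vertex -> {RV P >-> bool}).
Hypotheses (w_iid : iid_bernoulli w s) (s_ge0 : 0 <= s) (s_le1 : s <= 1).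

Let h : vertex -> R := mean_passage_time w.
Let g (x y : R) : R := shape_function w (x, y).
Let h_ge0 := mean_passage_time_ge0 w_iid s_ge0 s_le1.
Let h_le_level := mean_passage_time_le_level w_iid s_ge0 s_le1.
Let h_superadditive := mean_passage_time_superadditive w_iid s_ge0 s_le1.
Let h_le := mean_passage_time_le w_iid s_ge0 s_le1.
Let scaled (x y : R) (n : nat) : vertex :=
  (Num.truncn (n%:R * x), Num.truncn (n%:R * y)).

Let truncn_superadditive (x y : R) : 0 <= x -> 0 <= y ->
  (Num.truncn x + Num.truncn y <= Num.truncn (x + y))%N.
Proof.
move=> x0 y0; rewrite truncn_ge_nat ?addr_ge0 // natrD.
by apply: lerD; rewrite truncn_le.
Qed.

Let scaled_le_sup x y : 0 < x -> 0 < y ->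
  (h (scaled x y n) / n%:R @[n --> \oo] --> (g x y : R^o)) /\
  forall n, h (scaled x y n) <= g x y * n%:R.
Proof.
move=> x0 y0.
have [n|m n|n|L hL hle] := @superadditive_limit R (fun n => h (scaled x y n))
    _ _ (x + y).
- exact: h_ge0.
- apply: le_trans (h_superadditive _ _) _.
  apply: h_le => //=; rewrite natrD mulrDl;
    by apply: truncn_superadditive; rewrite mulr_ge0 // ltW.
- apply: le_trans (h_le_level _) _.
  rewrite /level /= natrD mulrDl mulrC [y * _]mulrC.
  by apply: lerD; rewrite truncn_le mulr_ge0 // ltW.
have -> : g x y = L by apply: cvg_lim.
by [].
Qed.

Lemma shape_function_cvg x y : 0 < x -> 0 < y ->
  h (scaled x y n) / n%:R @[n --> \oo] --> (g x y : R^o).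
Proof. by move=> x0 y0; case: (scaled_le_sup x0 y0). Qed.

Lemma mean_passage_time_scaled_le x y n : 0 < x -> 0 < y ->
  h (scaled x y n) <= g x y * n%:R.
Proof. by move=> x0 y0; case: (scaled_le_sup x0 y0). Qed.

Lemma mean_passage_time_le_shape (z : vertex) : (0 < z.1)%N -> (0 < z.2)%N ->
  h z <= g z.1%:R z.2%:R.
Proof.
move=> z1 z2; have := @mean_passage_time_scaled_le z.1%:R z.2%:R 1.
rewrite /scaled !mul1r !natrK mulr1 !ltr0n -surjective_pairing; exact.
Qed.

Lemma shape_function_swap x y : g x y = g y x.
Proof.
rewrite /g /shape_function /=; congr (lim _); congr (_ @ \oo).
apply: funext => n; rewrite -(mean_passage_time_swap w_iid) //.
Qed.

Lemma shape_function_ge0 x y : 0 < x -> 0 < y -> 0 <= g x y.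
Proof.
move=> x0 y0; have := @mean_passage_time_scaled_le x y 1 x0 y0.
by rewrite mulr1; apply: le_trans; exact: h_ge0.
Qed.

Lemma shape_function_nondecreasing x y x' y' : 0 < x -> 0 < y ->
  x <= x' -> y <= y' -> g x y <= g x' y'.
Proof.
move=> x0 y0 xx' yy'.
have x'0 := lt_le_trans x0 xx'; have y'0 := lt_le_trans y0 yy'.
apply: ler_cvg_to (shape_function_cvg x0 y0) (shape_function_cvg x'0 y'0) _.
near=> n; rewrite ler_wpM2r ?invr_ge0 //.
by apply: h_le => //=; apply: le_truncn; rewrite ler_wpM2l.
Unshelve. all: by end_near.
Qed.

Lemma shape_function_superadditive x y x' y' :
  0 < x -> 0 < y -> 0 < x' -> 0 < y' ->
  g x y + g x' y' <= g (x + x') (y + y').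
Proof.
move=> x0 y0 x'0 y'0.
apply: ler_cvg_to (cvgD (shape_function_cvg x0 y0) (shape_function_cvg x'0 y'0))
  (shape_function_cvg (addr_gt0 x0 x'0) (addr_gt0 y0 y'0)) _.
near=> n; rewrite /= -mulrDl ler_wpM2r ?invr_ge0 //.
apply: le_trans (h_superadditive _ _) _.
by apply: h_le => //=; rewrite mulrDr;
  apply: truncn_superadditive; rewrite mulr_ge0 // ltW.
Unshelve. all: by end_near.
Qed.

(** One inequality is superadditivity; for the other, the quotients along the
    multiples of [k.+1] stay below the limit of all of them. *)
Let shape_function_mul_nat k x y : 0 < x -> 0 < y ->
  k.+1%:R * g x y <= g (k.+1%:R * x) (k.+1%:R * y) <= k.+1%:R * g x y.
Proof.
move=> x0 y0; have k0 : 0 < k.+1%:R :> R by [].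
apply/andP; split.
  elim: k {k0} => [|k IH]; first by rewrite !mul1r.
  rewrite -[k.+2%:R]natr1 !mulrDl !mul1r.
  have k0 : 0 < k.+1%:R :> R by [].
  apply: le_trans (shape_function_superadditive _ _ _ _); rewrite ?mulr_gt0 //.
  by rewrite lerD2r.
have cv := shape_function_cvg (mulr_gt0 k0 x0) (mulr_gt0 k0 y0).
have <- : lim (h (scaled (k.+1%:R * x) (k.+1%:R * y) n) / n%:R @[n --> \oo])
   = g (k.+1%:R * x) (k.+1%:R * y) by apply: cvg_lim.
apply: limr_le; first by apply/cvg_ex; eexists; exact: cv.
near=> n.
have n0 : 0 < n%:R :> R by rewrite ltr0n; near: n; exact: nbhs_infty_gt.
rewrite ler_pdivrMr // -mulrA mulrCA -natrM mulnC.
apply: le_trans (mean_passage_time_scaled_le _ x0 y0).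
by rewrite /scaled !mulrA -!natrM.
Unshelve. all: by end_near.
Qed.

(** With [k] the integer part of [n c], monotonicity compares [k] with [n c],
    and the rounding error of [k / n] vanishes as [n] grows. *)
Let shape_function_superhomogeneous (c x y : R) : 0 < c -> 0 < x -> 0 < y ->
  c * g x y <= g (c * x) (c * y).
Proof.
move=> c0 x0 y0; rewrite leNgt; apply/negP => lt.
set G := g x y in lt; set G' := g (c * x) (c * y) in lt.
have dpos : 0 < c * G - G' by rewrite subr_gt0.
have G0 : 0 <= G by exact: shape_function_ge0.
have cx := mulr_gt0 c0 x0; have cy := mulr_gt0 c0 y0.
pose n := (Num.truncn (G / (c * G - G')) + Num.truncn c^-1).+1.
have n0 : 0 < n%:R :> R by [].
have hn : G < n%:R * (c * G - G').
  rewrite -ltr_pdivrMr //; apply: lt_le_trans (truncnS_gt _) _.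
  by rewrite ler_nat /n ltnS leq_addr.
have nc : 1 <= n%:R * c.
  rewrite -ler_pdivrMr // div1r; apply: ltW.
  apply: lt_le_trans (truncnS_gt _) _.
  by rewrite ler_nat /n ltnS leq_addl.
have k0 : (0 < Num.truncn (n%:R * c))%N by rewrite truncn_gt0.
case ek: (Num.truncn (n%:R * c)) k0 => [//|k] _.
have kle : k.+1%:R <= n%:R * c by rewrite -ek truncn_le mulr_ge0 // ltW.
have kgt : n%:R * c < k.+1%:R + 1 by rewrite -ek natr1 truncnS_gt.
have [h1 _] := andP (shape_function_mul_nat k x0 y0).
have /andP[_ h2] := shape_function_mul_nat (n.-1) cx cy.
rewrite -/n /= in h2.
have k0 : 0 < k.+1%:R :> R by [].
have h3 : g (k.+1%:R * x) (k.+1%:R * y) <= g (n%:R * (c * x)) (n%:R * (c * y)).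
  apply: shape_function_nondecreasing; rewrite ?mulr_gt0 // mulrA ler_pM2r //.
have := le_trans h1 (le_trans h3 h2); rewrite -/G -/G' => h4.
have h5 : n%:R * c * G <= (k.+1%:R + 1) * G by rewrite ler_wpM2r // ltW.
move: hn; rewrite mulrBr mulrA; move: h5; rewrite mulrDl; lra.
Qed.

(** Superhomogeneity is applied to [c] and to its inverse. *)
Lemma shape_function_homogeneous (c x y : R) : 0 < c -> 0 < x -> 0 < y ->
  g (c * x) (c * y) = c * g x y.
Proof.
move=> c0 x0 y0; apply/eqP; rewrite eq_le shape_function_superhomogeneous //.
rewrite andbT -ler_pdivrMl //.
have := @shape_function_superhomogeneous c^-1 (c * x) (c * y).
rewrite !mulrA mulVf ?gt_eqF // !mul1r invr_gt0 !mulr_gt0 //; exact.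
Qed.

End ShapeFunction.

(** * Curvature at the diagonal *)

Section Curvature.
Variables (R : realType) (g : R^o * R^o -> R^o).
Hypotheses (g_swap : forall x y, g (x, y) = g (y, x))
  (g_superadditive : forall x y x' y' : R, 0 < x -> 0 < y -> 0 < x' -> 0 < y' ->
     g (x, y) + g (x', y') <= g (x + x', y + y'))
  (g_homogeneous : forall c x y : R, 0 < c -> 0 < x -> 0 < y ->
     g (c * x, c * y) = c * g (x, y)).

Let f (q : R) : R := g (1 - q, 1 + q).

Let fN q : f (- q) = f q.
Proof. by rewrite /f opprK g_swap. Qed.

Let f_norm q : f `|q| = f q.
Proof.
by have [q0|q0] := leP 0 q; [rewrite ger0_norm | rewrite ltr0_norm // fN].
Qed.

Lemma homogeneous_perp (x y : R) : 0 < x -> 0 < y ->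
  g (x, y) = (x + y) / 2 * f ((y - x) / (x + y)).
Proof.
move=> x0 y0; have xy0 : 0 < x + y by exact: addr_gt0.
have e1 : 1 - (y - x) / (x + y) = 2 * x / (x + y) by field; rewrite gt_eqF.
have e2 : 1 + (y - x) / (x + y) = 2 * y / (x + y) by field; rewrite gt_eqF.
rewrite /f e1 e2 -g_homogeneous ?divr_gt0 ?mulr_gt0 //.
by congr (g (_, _)); field; rewrite gt_eqF.
Qed.

Lemma perp_le_center q : `|q| < 1 -> f q <= f 0.
Proof.
rewrite ltr_norml => /andP[q1 q2].
have := @g_superadditive (1 - q) (1 + q) (1 + q) (1 - q).
have -> : 1 - q + (1 + q) = 2 * (1 : R) by ring.
have -> : 1 + q + (1 - q) = 2 * (1 : R) by ring.
rewrite g_homogeneous // g_swap -/(f q).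
have -> : g (1, 1) = f 0 by rewrite /f subr0 addr0.
move=> h; have := h _ _ _ _; rewrite g_swap -/(f q); lra.
Qed.

(** Concavity of [f] between [0] and [q], from superadditivity and
    homogeneity. *)
Let perp_gap_chord t q : 0 < t -> t <= 1 -> `|q| < 1 ->
  f 0 - f (t * q) <= t * (f 0 - f q).
Proof.
move=> t0; rewrite le_eqVlt => /orP[/eqP -> |t1]; first by rewrite !mul1r.
rewrite ltr_norml => /andP[q1 q2].
have a0 : 0 < 1 - q by lra.
have b0 : 0 < 1 + q by lra.
have c0 : 0 < 1 - t by lra.
have := g_superadditive (mulr_gt0 t0 a0) (mulr_gt0 t0 b0)
                        (mulr_gt0 c0 ltr01) (mulr_gt0 c0 ltr01).
rewrite !g_homogeneous // -/(f q).
have -> : t * (1 - q) + (1 - t) * 1 = 1 - t * q by ring.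
have -> : t * (1 + q) + (1 - t) * 1 = 1 + t * q by ring.
rewrite -/(f (t * q)).
have -> : g (1, 1) = f 0 by rewrite /f subr0 addr0.
lra.
Qed.

(** Concavity turns a gap [f 0 - f q] that is small compared to one [q] into a
    gap that is small compared to all smaller ones, and homogeneity turns
    [f q = f 0 + o(q)] into a first order expansion of [g]. *)
Let differentiable_of_sublinear_gap :
  (forall c, 0 < c -> exists2 q, 0 < q < 1 & f 0 - f q <= c * q) ->
  differentiable g ((1, 1) : R^o * R^o).
Proof.
move=> flat.
pose df (z : R^o * R^o) : R^o := f 0 / 2 * (z.1 + z.2).
have dfL : linear df by move=> c u v; rewrite /df /= /GRing.scale /=; ring.
pose dfM := GRing.isLinear.Build _ _ _ _ _ dfL.
pose dL : {linear _ -> _} := HB.pack df dfM.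
have dLc : continuous dL.
  move=> z; apply: cvgM; first exact: cvg_cst.
  by apply: cvgD; [exact: cvg_fst | exact: cvg_snd].
suff E : g \o shift (1, 1) = cst (g (1, 1)) + dL +o_ (0 : R^o * R^o) id.
  apply/diff_locallyP; rewrite (diff_unique dLc E); split => //.
apply/eqaddoP => e e0.
have e3 : 0 < e / 3 by rewrite divr_gt0.
have [q1 /andP[q10 q11] hq1] := flat _ e3.
(* within this radius the slope [q] below is at most twice the norm *)
have r0 : 0 < Num.min (1 / 2) (q1 / 2).
  by rewrite lt_min !divr_gt0.
apply: filterS (@nbhs0_lt R (R^o * R^o)%type _ r0) => -[a b].
rewrite lt_min prod_normE /= => /andP[hr hq].
set m := Num.max `|a| `|b| in hr hq *.
have : `|a| <= m by rewrite le_max lexx.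
have : `|b| <= m by rewrite le_max lexx orbT.
rewrite !ler_norml => /andP[b1 b2] /andP[a1 a2].
have sg : 0 < a + 1 + (b + 1) by lra.
pose q := (b + 1 - (a + 1)) / (a + 1 + (b + 1)).
have gE : g ((a, b) + (1, 1)) = (1 + (a + b) / 2) * f q.
  have -> : (a, b) + (1, 1) = (a + 1, b + 1) :> R^o * R^o by [].
  rewrite homogeneous_perp; [|lra|lra].
  by congr (_ * _); field.
have qm : `|q| <= 2 * m.
  rewrite /q normrM normfV (gtr0_norm sg) ler_pdivrMr //.
  have hh : m * 2 <= m * (2 * (a + 1 + (b + 1))).
    by apply: ler_wpM2l; lra.
  rewrite ler_norml; apply/andP; split; lra.
have q1q : `|q| <= q1 by lra.
have gap : 0 <= f 0 - f q <= e / 3 * `|q|.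
  apply/andP; split; first by rewrite subr_ge0 perp_le_center //; lra.
  have [->|qn0] := eqVneq q 0; first by rewrite normr0 mulr0 subrr.
  have t0 : 0 < `|q| / q1 by rewrite divr_gt0 // normr_gt0.
  have t1 : `|q| / q1 <= 1 by rewrite ler_pdivrMr // mul1r.
  have hq1' : `|q1| < 1 by rewrite gtr0_norm.
  have := perp_gap_chord t0 t1 hq1'.
  rewrite divfK ?gt_eqF // f_norm => h; apply: le_trans h _.
  apply: le_trans (ler_wpM2l (ltW t0) hq1) _.
  by rewrite mulrCA divfK ?gt_eqF.
have -> : (g \o shift (1, 1) - (cst (g (1, 1)) + dL)) (a, b)
          = - ((1 + (a + b) / 2) * (f 0 - f q)).
  rewrite -[LHS]/(g ((a, b) + (1, 1)) - (g (1, 1) + df (a, b))) gE.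
  have -> : g (1, 1) = f 0 by rewrite /f subr0 addr0.
  by rewrite /df /=; field.
have c0 : 0 <= 1 + (a + b) / 2 by lra.
rewrite -ler_norml normrN normrM (ger0_norm c0).
case/andP: gap => gap0 gap; rewrite (ger0_norm gap0).
have c1 : 1 + (a + b) / 2 <= 3 / 2 by lra.
apply: le_trans (ler_pM c0 gap0 c1 gap) _.
rewrite mulrCA.
have -> : e * m = e / 3 * (3 / 2 * (2 * m)) by field.
by rewrite ler_pM2l // ler_pM2l.
Qed.

(** The curvature condition controls [f] near the center only; the chord
    inequality extends it to the whole interval.  At a point where [g] is not
    differentiable the gap is linear, for otherwise it would be sublinear. *)
Lemma perp_gap_ge (kappa : R) :
  1 <= kappa -> has_curvature_power_11 g kappa ->
  exists2 c, 0 < c & forall q, `|q| < 1 -> c * `|q| `^ kappa <= f 0 - f q.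
Proof.
move=> k1 [[_ [delta [c [C' [d0 c0 _ hc]]]]] | [nd ->]]; last first.
  apply: contrapT => no_c; apply: nd.
  apply: differentiable_of_sublinear_gap => c c0; apply: contrapT => none.
  apply: no_c; exists c => // q q1.
  rewrite powRr1 //; have [->|q0] := eqVneq q 0.
    by rewrite normr0 mulr0 subrr.
  rewrite leNgt; apply/negP => lt; apply: none; exists `|q|.
    by rewrite normr_gt0 q0 q1.
  by rewrite f_norm ltW.
(* [sqrt 2 < 2] and [|q| < 1], so the factor [t] brings every [q] into the
   range of the curvature condition *)
pose t := Num.min 1 (delta / 2).
have t0 : 0 < t by rewrite lt_min ltr01 divr_gt0.
have t1 : t <= 1 by rewrite ge_min lexx.
have td : t <= delta / 2 by rewrite ge_min lexx orbT.
have tk : 0 < t `^ kappa by rewrite powR_gt0.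
exists (c * t `^ kappa); first by rewrite mulr_gt0.
move=> q q1; apply: le_trans (_ : t * (f 0 - f q) <= _); last first.
  by rewrite ler_piMl // subr_ge0 perp_le_center.
apply: le_trans (perp_gap_chord t0 t1 q1).
pose z : R^o * R^o := (- (t * q), t * q).
have zo : dot_product z (1, 1) = 0 by rewrite /dot_product /= !mulr1 addNr.
have zn : euclidean_norm z = Num.sqrt 2 * (t * `|q|).
  rewrite /euclidean_norm /= sqrrN -mulr2n -[_ *+ 2]mulr_natl sqrtrM //.
  by rewrite sqrtr_sqr normrM gtr0_norm.
have s2l : 1 <= Num.sqrt 2 :> R by rewrite -[leLHS]sqrtr1 ler_sqrt // ler1n.
have s2r : Num.sqrt 2 < 2 :> R.
  rewrite -[ltRHS]ger0_norm // -sqrtr_sqr ltr_sqrt ?exprn_gt0 //.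
  by rewrite -natrX ltr_nat.
have tq0 : 0 <= t * `|q| by rewrite mulr_ge0 // ltW.
have zd : euclidean_norm z < delta.
  rewrite zn.
  have h1 : t * `|q| < t by rewrite gtr_pMr.
  have h2 : Num.sqrt 2 * (t * `|q|) <= 2 * (t * `|q|).
    by rewrite ler_wpM2r // ltW.
  lra.
have /andP[+ _] := hc z zo zd.
have -> : (1, 1) + z = (1 - t * q, 1 + t * q) by [].
rewrite -/(f (t * q)) -[g _]/(g (1, 1)).
have -> : g (1, 1) = f 0 by rewrite /f subr0 addr0.
have tq1 : `|t * q| < 1.
  by rewrite normrM gtr0_norm //; apply: le_lt_trans q1; rewrite ler_piMl.
rewrite ler0_norm ?subr_le0 ?perp_le_center // opprB; apply: le_trans.
rewrite zn -mulrA ler_pM2l // -powRM //; last exact: ltW.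
apply: ge0_ler_powR; rewrite ?nnegrE //; first lra.
  by rewrite mulr_ge0 // sqrtr_ge0.
by rewrite ler_peMl.
Qed.

End Curvature.

(** * Deviations along a path *)

(** A stretched exponential beats any power: in terms of [u = n^(gam/2)], the
    logarithm of the left-hand side is at most [ln K + O(u) - u^2/2]. *)
Lemma power_expR_small (R : realType) (gam K : R) : 0 < gam -> 0 < K ->
  exists N : nat, forall n : nat, (N <= n)%N ->
    K * n%:R ^+ 3 * expR (- (n%:R `^ gam / 2)) <= expR (- (n%:R `^ (gam / 2))).
Proof.
move=> gam0 K0.
pose M := 2 * (6 / gam + 1 + `|ln K|) + 1.
have g60 : 0 < 6 / gam by rewrite divr_gt0.
have lK := normr_ge0 (ln K).
have M1 : 1 <= M by rewrite /M; lra.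
have M0 : 0 < M by exact: lt_le_trans M1.
exists (Num.truncn (M `^ (2 / gam))).+1 => n hn.
have n0 : 0 < n%:R :> R by rewrite ltr0n; apply: leq_trans hn.
pose u := n%:R `^ (gam / 2).
have uM : M <= u.
  have -> : M = (M `^ (2 / gam)) `^ (gam / 2).
    rewrite -powRrM (_ : 2 / gam * (gam / 2) = 1) ?powRr1 ?ltW //.
    by field; rewrite gt_eqF.
  apply: ge0_ler_powR; rewrite ?nnegrE ?powR_ge0 ?divr_ge0 ?ltW //.
  by apply: lt_le_trans (truncnS_gt _) _; rewrite ler_nat.
have u0 : 0 < u by exact: lt_le_trans uM.
have u2 : n%:R `^ gam = u ^+ 2.
  rewrite -powR_mulrn ?ltW // -powRrM; congr (_ `^ _).
  by field.
have lnn : ln n%:R <= 2 / gam * u.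
  have -> : ln n%:R = 2 / gam * ln u.
    by rewrite /u ln_powR; field; rewrite gt_eqF.
  by rewrite ler_pM2l ?divr_gt0 // ltW // ln_sublinear.
have -> : K * n%:R ^+ 3 = expR (ln K + 3 * ln n%:R).
  by rewrite expRD lnK ?posrE // expRM_natl lnK ?posrE.
rewrite -expRD ler_expR u2 -/u.
have h1 : ln K <= `|ln K| by exact: ler_norm.
have h2 : M * u <= u ^+ 2 by rewrite expr2 ler_pM2r.
have h3 : 3 * ln n%:R <= 6 / gam * u.
  have -> : 6 / gam * u = 3 * (2 / gam * u) by field; rewrite gt_eqF.
  by rewrite ler_pM2l.
have u1 : 1 <= u by exact: le_trans uM.
have h4 : `|ln K| <= `|ln K| * u by rewrite ler_peMr.
move: h2; rewrite /M !mulrDl mul1r -mulrA !mulrDl mul1r; lra.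
Qed.

Lemma size_triangle N : (size (triangle N) <= N * N)%N.
Proof.
elim: N => [|N IH] //.
rewrite triangleS size_cat size_map size_iota; lia.
Qed.

Section Deviations.
Variables (R : realType) (d : measure_display) (T : measurableType d).
Variables (P : probability T R) (s : R) (w : vertex -> {RV P >-> bool}).
Hypotheses (w_iid : iid_bernoulli w s) (s_ge0 : 0 <= s) (s_le1 : s <= 1).
Variable beta : R.

Let h : vertex -> R := mean_passage_time w.
Let gam := beta - 1 / 2.

(** The inverse temperature at which deviations of order [L^beta] are already
    stretched-exponentially unlikely, while the exponential moments of passage
    times over [O(L)] levels stay bounded. *)
Definition inverse_temperature (L : nat) : R := (2 * Num.sqrt L%:R)^-1.
Local Notation lam := inverse_temperature.

Definition deviation (L : nat) (v v' : vertex) (u : vertex -> bool) : R :=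
  lam L * ((last_passage_time (shift_weight v u) v')%:R - h v' - L%:R `^ beta).

Let sqrt_gt0 (L : nat) : (0 < L)%N -> 0 < Num.sqrt L%:R :> R.
Proof. by move=> L0; rewrite sqrtr_gt0 ltr0n. Qed.

Let lam_gt0 L : (0 < L)%N -> 0 < lam L.
Proof. by move=> L0; rewrite invr_gt0 mulr_gt0 // sqrt_gt0. Qed.

Let lam_le L : (0 < L)%N -> lam L <= 1 / 2.
Proof.
move=> L0; rewrite /inverse_temperature invfM -[leRHS]mulr1 div1r.
rewrite ler_pM2l ?invr_gt0 //.
rewrite invf_le1 ?sqrt_gt0 // -[leLHS]sqrtr1 ler_sqrt ?ler0n //.
by rewrite ler1n.
Qed.

Let lam_beta L : (0 < L)%N -> lam L * L%:R `^ beta = L%:R `^ gam / 2.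
Proof.
move=> L0; rewrite /gam powRB ?pnatr_eq0 -?lt0n ?L0 ?implybT // div1r.
rewrite powR12_sqrt ?ler0n // /inverse_temperature invfM; ring.
Qed.

Lemma exponential_moment_deviation L v v' u : (0 < L)%N ->
  (level v + level v' <= 4 * L)%N ->
  resample s (triangle (4 * L).+1) (fun x => expR (deviation L v v' x)) u
    <= expR (3 - L%:R `^ gam / 2) /\
  resample s (triangle (4 * L).+1) (fun x => expR
     (- lam L * ((last_passage_time (shift_weight v x) v')%:R - h v'
                 + L%:R `^ beta))) u
    <= expR (3 - L%:R `^ gam / 2).
Proof.
move=> L0 vL.
have lamn : `|lam L| <= 1 / 2 by rewrite gtr0_norm ?lam_gt0 // lam_le.
have lamn' : `|- lam L| <= 1 / 2 by rewrite normrN.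
have e2 : 2 * lam L ^+ 2 * (4 * L).+1%:R <= 3.
  rewrite /inverse_temperature exprVn exprMn sqr_sqrtr ?ler0n //.
  have L1 : 1 <= L%:R :> R by rewrite ler1n.
  have L0R : 0 < L%:R :> R by rewrite ltr0n.
  rewrite mulrAC ler_pdivrMr ?mulr_gt0 ?exprn_gt0 //.
  rewrite -[(4 * L).+1%:R]natr1 natrM; lra.
have l1 := exponential_moment_passage_time w_iid s_ge0 s_le1 u
  (N := (4 * L).+1) (z := v) (z' := v') _ lamn.
have l2 := exponential_moment_passage_time w_iid s_ge0 s_le1 u
  (N := (4 * L).+1) (z := v) (z' := v') _ lamn'.
have E c (F : (vertex -> bool) -> R) :
  resample s (triangle (4 * L).+1) F u
    <= expR (2 * lam L ^+ 2 * (4 * L).+1%:R) ->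
  expR c * resample s (triangle (4 * L).+1) F u <= expR (3 + c).
  move=> hF; apply: le_trans (ler_wpM2l (expR_ge0 _) hF) _.
  by rewrite -expRD ler_expR addrC lerD2r.
split.
  have := E (- (L%:R `^ gam / 2)) _ (l1 vL); rewrite -resampleZ.
  congr (_ <= _); congr resample; apply: funext => x.
  by rewrite -expRD -lam_beta // /deviation /h; congr expR; ring.
move: l2; rewrite sqrrN => l2.
have := E (- (L%:R `^ gam / 2)) _ (l2 vL); rewrite -resampleZ.
congr (_ <= _); congr resample; apply: funext => x.
by rewrite -expRD -lam_beta // /h; congr expR; ring.
Qed.

(** One random variable that dominates the upward deviations of both pieces of
    every path to [z]; a [v] that no such path meets only adds a positive
    term. *)
Definition deviation_sum (L : nat) (z : vertex) (u : vertex -> bool) : R :=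
  \sum_(v <- triangle (2 * L).+1)
    (expR (deviation L (0, 0)%N v u) + expR (deviation L v (sub_vertex z v) u)).

Lemma deviation_sum_ge0 L z u : 0 <= deviation_sum L z u.
Proof. by apply: sumr_ge0 => v _; rewrite addr_ge0 ?expR_ge0. Qed.

Let le_deviation L v v' u : (0 < L)%N ->
  (last_passage_time (shift_weight v u) v')%:R
  <= h v' + L%:R `^ beta + 2 * Num.sqrt L%:R * expR (deviation L v v' u).
Proof.
move=> L0; have l0 := lam_gt0 L0.
have := expR_ge1Dx (deviation L v v' u).
have -> : 2 * Num.sqrt L%:R = (lam L)^-1 by rewrite /inverse_temperature invrK.
move=> e; rewrite -lerBlDl ler_pdivlMl //.
apply: le_trans e; rewrite /deviation; lra.
Qed.

(** The error term does not depend on the path or on [v], so it can be averaged,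
    or bounded once for all geodesics. *)
Lemma passage_time_le_mean L z p v u : (0 < L)%N -> level z = (2 * L)%N ->
  directed_path z p -> v \in (0, 0)%N :: p ->
  (passage_time u p)%:R <= h v + h (sub_vertex z v) + 2 * L%:R `^ beta
                           + 2 * Num.sqrt L%:R * deviation_sum L z u.
Proof.
move=> L0 zL hp vp; have [z' ez hz'] := passage_time_le_through u hp vp.
have -> : sub_vertex z v = z' by rewrite ez add_vertexK.
apply: (@le_trans _ _ ((last_passage_time u v)%:R
   + (last_passage_time (shift_weight v u) z')%:R)).
  by rewrite -natrD ler_nat.
have h1 := @le_deviation L (0, 0)%N v u L0.
have h2 := @le_deviation L v z' u L0.
rewrite shift_weight0 in h1.
have vt : v \in triangle (2 * L).+1.
  by rewrite mem_triangle ltnS -zL ez level_add leq_addr.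
have h3 : expR (deviation L (0, 0)%N v u) + expR (deviation L v z' u)
          <= deviation_sum L z u.
  rewrite /deviation_sum (big_rem v vt) /=.
  have -> : sub_vertex z v = z' by rewrite ez add_vertexK.
  by rewrite lerDl sumr_ge0 // => x _; rewrite addr_ge0 ?expR_ge0.
have s2 : 0 <= 2 * Num.sqrt L%:R :> R by rewrite mulr_ge0 // sqrtr_ge0.
have := ler_wpM2l s2 h3; rewrite mulrDr; lra.
Qed.

Lemma resample_deviation_sum L z u : (0 < L)%N -> level z = (2 * L)%N ->
  resample s (triangle (4 * L).+1) (deviation_sum L z) u
  <= 18 * L%:R ^+ 2 * expR (3 - L%:R `^ gam / 2).
Proof.
move=> L0 zL; rewrite resample_sum.
set e := expR _; have e0 : 0 <= e by exact: expR_ge0.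
apply: (@le_trans _ _ (\sum_(v <- triangle (2 * L).+1) 2 * e)).
  rewrite big_seq [leRHS]big_seq; apply: ler_sum => v.
  rewrite mem_triangle ltnS resampleD => vL.
  have [h1 _] := @exponential_moment_deviation L (0, 0)%N v u L0
                  (leq_trans vL (leq_mul (isT : (2 <= 4)%N) (leqnn L))).
  have vL2 : (level v + level (sub_vertex z v) <= 4 * L)%N.
    by move: vL zL; rewrite /level /sub_vertex /=; lia.
  have [h2 _] := @exponential_moment_deviation L v (sub_vertex z v) u L0 vL2.
  by rewrite mulrDl mul1r; apply: lerD.
rewrite big_const_seq count_predT iter_addr_0 -[leLHS]mulr_natl mulrA.
rewrite ler_wpM2r //.
have := size_triangle (2 * L).+1; rewrite -(ler_nat R) => hs.
have L1 : 1 <= L%:R :> R by rewrite ler1n.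
apply: (@le_trans _ _ (((2 * L).+1 * (2 * L).+1)%:R * 2)).
  by rewrite ler_pM2r.
rewrite natrM -[(2 * L).+1%:R]natr1 natrM; nra.
Qed.

End Deviations.

(** * The mean passage time to the diagonal *)

Section NonrandomFluctuation.
Variables (R : realType) (d : measure_display) (T : measurableType d).
Variables (P : probability T R) (s : R) (w : vertex -> {RV P >-> bool}).
Hypotheses (w_iid : iid_bernoulli w s) (s_ge0 : 0 <= s) (s_le1 : s <= 1).
Variable beta : R.
Hypotheses (beta_gt : 1 / 2 < beta) (beta_lt1 : beta < 1).

Let h : vertex -> R := mean_passage_time w.
Let beta_gt0 : 0 < beta.
Proof. by apply: lt_trans beta_gt; rewrite divr_gt0. Qed.

Let powR_ge1 (n : nat) (x : R) : (0 < n)%N -> 0 <= x -> 1 <= n%:R `^ x.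
Proof.
by move=> n0 x0; rewrite -[leLHS](powRr0 n%:R); apply: ler_powR; rewrite ?ler1n.
Qed.

(** A geodesic to level [2L] crosses level [L], so its passage time is the sum
    of two passage times over [L] levels, maximized over the crossing point. *)
Lemma mean_passage_time_doubling : exists N : nat, forall (L : nat) (H : R),
  (N < L)%N -> (forall v, level v = L -> h v <= H) ->
  forall z, level z = (2 * L)%N -> h z <= 2 * H + 3 * L%:R `^ beta.
Proof.
have gam0 : 0 < beta - 1 / 2 by rewrite subr_gt0.
have K0 : 0 < 36 * expR 3 :> R by rewrite mulr_gt0 // expR_gt0.
have [N hN] := power_expR_small gam0 K0.
(* [36 = 2 * 18], from the factors [2 sqrt L] and [18 L^2] of the error *)
exists N => L H NL hH z zL.
have L0 : (0 < L)%N by apply: leq_ltn_trans NL.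
pose u : vertex -> bool := fun=> true.
have zt : (level z < (4 * L).+1)%N by rewrite zL; lia.
rewrite /h (mean_passage_timeE0 w_iid u zt).
pose S x := 2 * H + 2 * L%:R `^ beta
            + 2 * Num.sqrt L%:R * deviation_sum w beta L z x.
apply: (@le_trans _ _ (resample s (triangle (4 * L).+1) S u)).
  apply: resample_le => // x _.
  have [p hp ->] := last_passage_time_attained x z.
  have [|v vp vL] := directed_path_level_vertex (k := L) hp.
    by rewrite zL; lia.
  apply: le_trans (passage_time_le_mean w beta x L0 zL hp vp) _.
  rewrite /S !lerD2r (_ : 2 * H = H + H); last by ring.
  apply: lerD; apply: hH => //.
  have [z' ez _] := passage_time_le_through x hp vp.
  rewrite ez add_vertexK; rewrite ez level_add in zL.
  by move: zL; rewrite vL; lia.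
rewrite /S resampleD resample_cst resampleZ.
have hs := resample_deviation_sum w_iid s_ge0 s_le1 beta u L0 zL.
have sL : Num.sqrt L%:R <= L%:R :> R.
  rewrite -[leRHS]ger0_norm // -sqrtr_sqr ler_sqrt ?exprn_ge0 //.
  by rewrite -natrX ler_nat -[X in (X <= _)%N]expn1 leq_pexp2l.
have hs2 : 2 * Num.sqrt L%:R * resample s (triangle (4 * L).+1)
              (deviation_sum w beta L z) u <= 1.
  apply: (@le_trans _ _ (2 * L%:R * (18 * L%:R ^+ 2
      * expR (3 - L%:R `^ (beta - 1 / 2) / 2)))).
    apply: ler_pM; rewrite ?mulr_ge0 ?sqrtr_ge0 //; last by rewrite ler_pM2l.
    by apply: resample_ge_cst => // x _; exact: deviation_sum_ge0.
  apply: le_trans (_ : expR (- L%:R `^ ((beta - 1 / 2) / 2)) <= _); last first.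
    by rewrite -expR0 ler_expR oppr_le0 powR_ge0.
  apply: le_trans (hN L (ltnW NL)); rewrite expRD le_eqVlt; apply/orP; left.
  by apply/eqP; ring.
have := powR_ge1 L0 (ltW beta_gt0); lra.
Qed.

(** By symmetry, a path to [v] continued by the transposed path ends on the
    diagonal, so the mean passage times over [n] levels are at most half of the
    one to [(n, n)]; doubling the scale then loses only [O(n^beta)], because
    the errors form a geometric series of ratio [2^(beta - 1)]. *)
Lemma shape_function_le_mean : exists (B : R) (N : nat), 0 < B /\
  forall n : nat, (N < n)%N ->
    shape_function w (1, 1) * n%:R <= h (n, n) + 2 * B * n%:R `^ beta.
Proof.
have [N hN] := mean_passage_time_doubling.
have b2 : 2 `^ beta < 2 :> R.
  rewrite -ltr_ln ?posrE ?powR_gt0 // ln_powR gtr_pMl //.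
  by rewrite ln_gt0 // ltr1n.
have b20 : 0 < 2 - 2 `^ beta :> R by rewrite subr_gt0.
(* [B] makes [h z + B L^beta], for the largest [h z] over [L] steps, at most
   double when [L] doubles: [3 + 2^beta B = 2 B] *)
pose B : R := 3 / (2 - 2 `^ beta).
have B0 : 0 < B by rewrite divr_gt0.
have BE : 3 = B * (2 - 2 `^ beta) by rewrite divfK // gt_eqF.
exists B, N; split=> // n Nn.
have n0 : (0 < n)%N by apply: leq_ltn_trans Nn.
have n0R : 0 < n%:R :> R by rewrite ltr0n.
pose c := h (n, n) / 2 + B * n%:R `^ beta.
have iter k z : level z = (2 ^ k * n)%N ->
    h z <= 2 ^+ k * c - B * (2 ^ k * n)%:R `^ beta.
  elim: k z => [|k IH] z.
    rewrite expn0 mul1n expr0 mul1r /c addrK => zn.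
    have := mean_passage_time_superadditive w_iid s_ge0 s_le1 z (swap_vertex z).
    rewrite (mean_passage_time_swap w_iid) -/h.
    have -> : add_vertex z (swap_vertex z) = (n, n).
      by rewrite /add_vertex /swap_vertex /= -zn /level [(z.2 + z.1)%N]addnC.
    by rewrite ler_pdivlMr // mulr_natr mulr2n.
  rewrite expnS -mulnA => zL.
  have Nk : (N < 2 ^ k * n)%N.
    by apply: leq_trans Nn _; rewrite leq_pmull // expn_gt0.
  apply: le_trans (hN _ _ Nk IH z zL) _.
  rewrite exprS [(2 * (2 ^ k * n))%:R]natrM powRM // [in leLHS]BE.
  rewrite le_eqVlt; apply/orP; left; apply/eqP; ring.
have shape_le : shape_function w (1, 1)
                <= (h (n, n) + 2 * B * n%:R `^ beta) / n%:R.
  apply: (limit_le_unbounded (N := fun k => (2 ^ k * n)%N)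
    (shape_function_cvg w_iid s_ge0 s_le1 ltr01 ltr01)) => k.
    by apply: leq_trans (ltn_expl k (ltnSn 1)) _; rewrite leq_pmulr.
  rewrite mulr1 natrK -/h.
  have lk : level ((2 ^ k * n)%N, (2 ^ k * n)%N) = (2 ^ k.+1 * n)%N.
    by rewrite /level /= expnS -mulnA mul2n addnn.
  apply: le_trans (iter _ _ lk) _.
  apply: le_trans (_ : 2 ^+ k.+1 * c <= _).
    by rewrite lerBlDr lerDl mulr_ge0 ?powR_ge0 // ltW.
  rewrite natrM natrX [_ * n%:R]mulrC mulrA divfK ?gt_eqF // exprS /c.
  rewrite le_eqVlt; apply/orP; left; by apply/eqP; field.
by move: shape_le; rewrite ler_pdivlMr.
Qed.

End NonrandomFluctuation.

(** * Geodesics stay close to the diagonal *)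

(** Moving both end pieces away from the coordinate axes by [(1, 1)] puts them
    where the shape function is meaningful.  The piece before the vertex pays
    for its slope; the other one is at most straight. *)
Lemma mean_passage_time_two_pieces (R : realType) (d : measure_display)
    (T : measurableType d) (P : probability T R) (s : R)
    (w : vertex -> {RV P >-> bool}) (kappa c : R) (n x y : nat) :
  iid_bernoulli w s -> 0 <= s -> s <= 1 -> 1 <= kappa -> 0 < c ->
  (forall q, `|q| < 1 -> c * `|q| `^ kappa <=
     shape_function w (1, 1) - shape_function w (1 - q, 1 + q)) ->
  (x <= n)%N -> (y <= n)%N ->
  mean_passage_time w (x, y) + mean_passage_time w (sub_vertex (n, n) (x, y))
  <= (n%:R + 2) * (shape_function w (1, 1)
                   - c * (`|x%:R - y%:R| / (2 * n%:R + 4)) `^ kappa).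
Proof.
move=> wi s0 s1 k1 c0 gap xn yn.
pose g : R^o * R^o -> R^o := shape_function w.
have hom := shape_function_homogeneous wi s0 s1.
have sup := shape_function_superadditive wi s0 s1.
have swp := shape_function_swap wi.
pose f (q : R) : R := g (1 - q, 1 + q).
have f0 : g (1, 1) = f 0 by rewrite /f subr0 addr0.
have piece (a b : nat) : mean_passage_time w (a, b)
    <= (a%:R + b%:R + 2) / 2 * f ((b%:R - a%:R) / (a%:R + b%:R + 2)).
  apply: (@le_trans _ _ (mean_passage_time w (a.+1, b.+1))).
    by apply: (mean_passage_time_le wi s0 s1) => /=; exact: leqnSn.
  have := mean_passage_time_le_shape wi s0 s1 (z := (a.+1, b.+1)) isT isT.
  rewrite /= (homogeneous_perp hom) ?ltr0n // -/g -/(f _) => hh.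
  apply: le_trans hh _; rewrite -[a.+1%:R]natr1 -[b.+1%:R]natr1.
  have -> : b%:R + 1 - (a%:R + 1) = b%:R - a%:R :> R by ring.
  by have -> : a%:R + 1 + (b%:R + 1) = a%:R + b%:R + 2 :> R by ring.
have slope (a b : nat) : `|(b%:R - a%:R) / (a%:R + b%:R + 2)| < 1 :> R.
  have a0 : 0 <= a%:R :> R by [].
  have b0 : 0 <= b%:R :> R by [].
  have ab : 0 < a%:R + b%:R + 2 :> R by lra.
  rewrite normrM normfV (gtr0_norm ab) ltr_pdivrMr // mul1r ltr_norml.
  by apply/andP; split; lra.
have p1 := piece x y; have p2 := piece (n - x)%N (n - y)%N.
have c2 := perp_le_center swp sup hom (slope (n - x)%N (n - y)%N).
have c1 := gap _ (slope x y).
rewrite -/g -/(f _) f0 in c1; rewrite -/g -/(f _) -/(f _) in c2.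
rewrite -/g f0.
set q := (y%:R - x%:R) / _ in p1 c1.
set q' := (_ - _) / _ in p2 c2.
have x0 : 0 <= x%:R :> R by [].
have y0 : 0 <= y%:R :> R by [].
have xnR : x%:R <= n%:R :> R by rewrite ler_nat.
have ynR : y%:R <= n%:R :> R by rewrite ler_nat.
pose m : R := x%:R + y%:R + 2; pose M : R := 2 * n%:R + 4.
have m0 : 0 < m by rewrite /m; lra.
have M0 : 0 < M by rewrite /M; lra.
have m0' : 0 <= m / 2 by lra.
have mM : m <= M by rewrite /m /M; lra.
have rho : `|x%:R - y%:R| / M = m / M * `|q|.
  rewrite /q normrM normfV -/m (gtr0_norm m0) distrC.
  by field; rewrite !gt_eqF.
have r0 : 0 < m / M by rewrite divr_gt0.
have r1 : m / M <= 1 by rewrite ler_pdivrMr // mul1r.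
(* as [kappa >= 1], a given displacement is cheapest when spread over the whole
   length [M] *)
have hr : M * (`|x%:R - y%:R| / M) `^ kappa <= m * `|q| `^ kappa.
  rewrite rho powRM //; last exact: ltW.
  have -> : m * `|q| `^ kappa = M * (m / M * `|q| `^ kappa).
    by field; rewrite gt_eqF.
  rewrite ler_pM2l //; apply: ler_wpM2r; first exact: powR_ge0.
  by apply: ge1r_powR => //; rewrite r0 r1.
have p2' : mean_passage_time w (sub_vertex (n, n) (x, y)) <= (M - m) / 2 * f 0.
  apply: le_trans p2 _; rewrite !natrB //.
  have -> : n%:R - x%:R + (n%:R - y%:R) + 2 = M - m :> R by rewrite /m /M; ring.
  by rewrite ler_wpM2l // /M /m; lra.
have p1' : mean_passage_time w (x, y) <= m / 2 * (f 0 - c * `|q| `^ kappa).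
  by apply: le_trans p1 _; rewrite ler_wpM2l //; lra.
have -> : n%:R + 2 = M / 2 by rewrite /M; lra.
have := ler_wpM2l (ltW c0) hr; lra.
Qed.

Definition near_diagonal (R : realType) (D : R) (n : nat)
    (u : vertex -> bool) : Prop :=
  forall p, geodesic u (n, n) p -> forall x y : nat, (x, y) \in (0, 0)%N :: p ->
    `|x%:R - y%:R| <= D.

Lemma eq_geodesic (u u' : vertex -> bool) z :
  (forall v, (v.1 <= z.1)%N -> (v.2 <= z.2)%N -> u v = u' v) ->
  geodesic u z =1 geodesic u' z.
Proof.
move=> e p; rewrite /geodesic (eq_last_passage_time e).
case hp: (directed_path z p) => //=; congr (_ == _).
by apply: eq_passage_time => v /(directed_path_le hp)[]; exact: e.
Qed.

(** Solving the energy balance for the displacement [X].  With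
    [beta = (kappa + 3) / (2 kappa + 3)] and
    [alpha = (2 kappa + 2) / (2 kappa + 3)] one has
    [beta - 1 = kappa (alpha - 1)], so a displacement of order [n^alpha] costs
    exactly the order [n^beta] of the fluctuations. *)
Lemma displacement_le (R : realType) (kappa c A X : R) (n : nat) :
  1 <= kappa -> 0 < c -> 0 <= A -> 0 <= X -> expR 1 <= n%:R :> R ->
  c * (n%:R * (X / (2 * n%:R + 4)) `^ kappa)
    <= A * n%:R `^ ((kappa + 3) / (2 * kappa + 3)) ->
  X <= 6 * (A / c + 1) * n%:R `^ ((2 * kappa + 2) / (2 * kappa + 3))
       * Num.sqrt (ln n%:R).
Proof.
move=> k1 c0 A0 X0 en.
have n0 : 0 < n%:R :> R by exact: lt_le_trans (expR_gt0 1) en.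
have n1 : 1 <= n%:R :> R by rewrite ler1n -(ltr0n R).
have den0 : 0 < 2 * kappa + 3 by lra.
set alpha := (2 * kappa + 2) / _; set beta := (kappa + 3) / _ => loss.
have ab : beta - 1 = (alpha - 1) * kappa.
  by rewrite /beta /alpha; field; rewrite gt_eqF.
have b0 : 0 < beta by rewrite divr_gt0 //; lra.
set C := 6 * _; set rho := X / _ in loss.
have C6 : C / 6 = A / c + 1 by rewrite /C; field; rewrite gt_eqF.
have C0 : 0 < C by rewrite mulr_gt0 // ltr_wpDl // divr_ge0 // ltW.
rewrite leNgt; apply/negP => Xlt.
have XC : C * n%:R `^ alpha <= X.
  apply: ltW; apply: le_lt_trans Xlt; rewrite ler_peMr //.
    by rewrite mulr_ge0 ?powR_ge0 // ltW.
  rewrite -[leLHS]sqrtr1 ler_sqrt ?ln_ge0 // -[leLHS](expRK 1).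
  by rewrite ler_ln ?posrE ?expR_gt0.
have rho_ge : C / 6 * n%:R `^ (alpha - 1) <= rho.
  have -> : n%:R `^ (alpha - 1) = n%:R `^ alpha / n%:R :> R.
    by rewrite powRB ?powRr1 ?(gt_eqF n0) ?implybT ?ler0n.
  rewrite ler_pdivlMr; last by lra.
  (* the factor 6 in [C] absorbs [2 n + 4 <= 6 n] *)
  apply: le_trans (_ : C / 6 * (n%:R `^ alpha / n%:R) * (6 * n%:R) <= _).
    rewrite ler_wpM2l ?mulr_ge0 ?divr_ge0 ?powR_ge0 ?ler0n ?(ltW C0) //; lra.
  have -> // : C / 6 * (n%:R `^ alpha / n%:R) * (6 * n%:R) = C * n%:R `^ alpha.
  by field; rewrite gt_eqF.
have rk : (C / 6) `^ kappa * n%:R `^ (beta - 1) <= rho `^ kappa.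
  have l0 : 0 <= C / 6 by rewrite divr_ge0 // ltW.
  have l1 : 0 <= C / 6 * n%:R `^ (alpha - 1) by rewrite mulr_ge0 ?powR_ge0.
  rewrite ab powRrM -powRM ?powR_ge0 //.
  by apply: ge0_ler_powR; rewrite ?nnegrE ?(le_trans l1 rho_ge) //; lra.
have Ck : A / c + 1 <= (C / 6) `^ kappa.
  by rewrite C6; apply: le1r_powR => //; rewrite lerDr divr_ge0 // ltW.
have : c * (n%:R * ((A / c + 1) * n%:R `^ (beta - 1))) <= A * n%:R `^ beta.
  apply: le_trans loss; rewrite ler_pM2l // ler_pM2l //.
  by apply: le_trans rk; rewrite ler_wpM2r // powR_ge0.
have -> : c * (n%:R * ((A / c + 1) * n%:R `^ (beta - 1)))
          = (A + c) * (n%:R * n%:R `^ (beta - 1)) by field; rewrite gt_eqF.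
rewrite mulr_powRB1 //.
have : 0 < c * n%:R `^ beta by rewrite mulr_gt0 // powR_gt0.
lra.
Qed.

(** The exceptional event is covered by large values of the deviation sum,
    which bounds passage times from above, and by one lower deviation of the
    passage time to the corner. *)
Lemma probability_near_diagonal (R : realType) (d : measure_display)
    (T : measurableType d) (P : probability T R) (s : R)
    (w : vertex -> {RV P >-> bool}) (beta D : R) (n : nat) :
  iid_bernoulli w s -> 0 <= s -> s <= 1 -> 1 / 2 < beta -> (0 < n)%N ->
  (forall u, deviation_sum w beta n (n, n) u <= 1 ->
     mean_passage_time w (n, n) - n%:R `^ beta
       < (last_passage_time u (n, n))%:R ->
     near_diagonal D n u) ->
  ((1 - 19 * n%:R ^+ 3 * expR (3 - n%:R `^ (beta - 1 / 2) / 2))%:E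
   <= P [set t | near_diagonal D n (fun v => w v t)])%E.
Proof.
move=> w_iid s0 s1 b1 n0 good.
pose u0 : vertex -> bool := fun=> true.
pose S := deviation_sum w beta n (n, n).
pose E u : R := expR (- inverse_temperature R n *
  ((last_passage_time u (n, n))%:R - mean_passage_time w (n, n)
   + n%:R `^ beta)).
have n1 : 1 <= n%:R :> R by rewrite ler1n.
have lvl : level (n, n) = (2 * n)%N by rewrite /level /= mul2n addnn.
have {}good u : S u <= 1 -> E u < 1 -> near_diagonal D n u.
  move=> Su; rewrite -expR0 ltr_expR mulNr oppr_lt0 pmulr_rgt0; last first.
    by rewrite invr_gt0 mulr_gt0 // sqrtr_gt0 ltr0n.
  by move=> Eu; apply: good => //; lra.
have detA : determined_by (triangle (4 * n).+1)
    (fun u => `[< near_diagonal D n u >]).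
  move=> u u' uu'.
  have e : geodesic u (n, n) =1 geodesic u' (n, n).
    apply: eq_geodesic => v /= v1 v2; apply: uu'; rewrite mem_triangle /level.
    by move: v1 v2; clear; lia.
  by apply: asbool_equiv_eq; split=> hu p hp; apply: hu; rewrite ?e // -e.
have -> : [set t | near_diagonal D n (fun v => w v t)]
          = [set t | `[< near_diagonal D n (fun v => w v t) >]].
  by apply/seteqP; split => t /asboolP.
rewrite (probability_weights w_iid u0 (triangle_uniq _) detA) lee_fin.
apply: (@le_trans _ _ (resample s (triangle (4 * n).+1)
   (fun u => 1 + -1 * (S u + E u)) u0)); last first.
  apply: resample_le => // u _.
  have E0 : 0 <= E u by exact: expR_ge0.
  have S0 : 0 <= S u by exact: deviation_sum_ge0.
  have [Su|Su] := leP (S u) 1; last first.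
    by apply: (@le_trans _ _ 0); [lra|exact: ler0n].
  have [Eu|Eu] := ltP (E u) 1; last first.
    by apply: (@le_trans _ _ 0); [lra|exact: ler0n].
  have -> : `[< near_diagonal D n u >] by apply/asboolP; exact: good.
  by apply: (@le_trans _ _ 1); [lra|exact: lexx].
rewrite resampleD resampleZ resample_cst resampleD.
set e := expR (3 - n%:R `^ (beta - 1 / 2) / 2).
have hS : resample s (triangle (4 * n).+1) S u0 <= 18 * n%:R ^+ 2 * e.
  exact: resample_deviation_sum.
have hE : resample s (triangle (4 * n).+1) E u0 <= e.
  have [|_] := exponential_moment_deviation w_iid s0 s1 beta (v := (0, 0)%N)
    (v' := (n, n)) u0 n0; first by rewrite lvl leq_mul.
  apply: le_trans; rewrite le_eqVlt; apply/orP; left; apply/eqP.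
  by congr resample; apply: funext => u; rewrite shift_weight0.
have e0 : 0 <= e by exact: expR_ge0.
have p1 : 1 * e <= n%:R ^+ 3 * e by rewrite ler_wpM2r // exprn_ege1.
have p2 : n%:R ^+ 2 * e <= n%:R ^+ 3 * e by rewrite ler_wpM2r // ler_weXn2l.
move: hS hE p1 p2; rewrite -!mulrA mul1r; lra.
Qed.

Theorem theorem2p5 (R : realType) (d : measure_display) (T : measurableType d)
    (P : probability T R) (s : R) (w : vertex -> {RV P >-> bool}) (kappa : R)
    (s_gt0 : 0 < s) (s_lt1 : s < 1)
    (w_iid : iid_bernoulli w s)
    (kappa_ge1 : 1 <= kappa)
    (kappa_curv : has_curvature_power_11 (shape_function w) kappa) :
  exists (C a : R) (N : nat), 0 < C /\ 0 < a /\
    forall n : nat, (N <= n)%N ->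
      ((1 - 2 * expR (- (n%:R `^ a)))%:E <=
       P [set t | forall p : seq vertex,
            geodesic (fun v => w v t) (n, n) p ->
            forall x y : nat, (x, y) \in (0, 0)%N :: p ->
              (`|x%:R - y%:R| <=
                C * n%:R `^ ((2 * kappa + 2) / (2 * kappa + 3))
                  * Num.sqrt (ln n%:R))%R])%E.
Proof.
have s0 := ltW s_gt0; have s1 := ltW s_lt1.
have den0 : 0 < 2 * kappa + 3 by lra.
pose beta := (kappa + 3) / (2 * kappa + 3).
have b1 : 1 / 2 < beta by rewrite /beta ltr_pdivlMr //; lra.
have b2 : beta < 1 by rewrite /beta ltr_pdivrMr //; lra.
have gam0 : 0 < beta - 1 / 2 by lra.
have [c c0 gap] := perp_gap_ge (shape_function_swap w_iid)
  (shape_function_superadditive w_iid s0 s1)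
  (shape_function_homogeneous w_iid s0 s1) kappa_ge1 kappa_curv.
have {}gap q : `|q| < 1 -> c * `|q| `^ kappa <=
    shape_function w (1, 1) - shape_function w (1 - q, 1 + q).
  by move=> /gap; rewrite subr0 addr0.
have [B [N1 [B0 hN1]]] := shape_function_le_mean w_iid s0 s1 b1 b2.
have K0 : 0 < 19 * expR 3 :> R by rewrite mulr_gt0 // expR_gt0.
have [N2 hN2] := power_expR_small gam0 K0.
have g0 : 0 <= shape_function w (1, 1).
  exact: (shape_function_ge0 w_iid s0 s1 ltr01 ltr01).
(* [2 * B] from the mean, [1] from the lower deviation, [2 + 2] from the
   deviations of the two pieces, and the shift of the corner by [(2, 2)] *)
pose A := 2 * B + 5 + 2 * shape_function w (1, 1).
have A0 : 0 < A by rewrite /A; lra.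
pose N3 := Num.truncn (expR 1 : R).
exists (6 * (A / c + 1)), ((beta - 1 / 2) / 2), (N1 + N2 + N3 + 1)%N; split.
  by rewrite mulr_gt0 // ltr_wpDl // divr_ge0 // ltW.
split; first by rewrite divr_gt0.
move=> n hn.
have nN1 : (N1 < n)%N by move: hn; clear; lia.
have nN2 : (N2 <= n)%N by move: hn; clear; lia.
have n0 : (0 < n)%N by move: hn; clear; lia.
have en : expR 1 <= n%:R :> R.
  apply: ltW; apply: lt_le_trans (truncnS_gt _) _.
  by rewrite ler_nat; move: hn; rewrite -/N3; clear; lia.
have n1 : 1 <= n%:R :> R by rewrite ler1n.
set D := _ * Num.sqrt _.
have nb1 : 1 <= n%:R `^ beta.
  by rewrite -[leLHS](powRr0 n%:R); apply: ler_powR => //; lra.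
have sqb : Num.sqrt n%:R <= n%:R `^ beta.
  by rewrite -powR12_sqrt ?ler0n //; apply: ler_powR => //; lra.
have sq0 : 0 < Num.sqrt n%:R :> R by rewrite sqrtr_gt0 ltr0n.
apply: le_trans (_ : (1 - 19 * n%:R ^+ 3
    * expR (3 - n%:R `^ (beta - 1 / 2) / 2))%:E <= _)%E.
  have := hN2 n nN2; rewrite lee_fin (expRD 3).
  have : 0 <= expR (- n%:R `^ ((beta - 1 / 2) / 2)) by exact: expR_ge0.
  lra.
apply: (probability_near_diagonal w_iid) => // u Su Tu p.
move=> /andP[hp /eqP pe] x y xy.
have [xn yn] : (x <= n)%N /\ (y <= n)%N.
  move: xy; rewrite inE => /orP[/eqP[-> ->] //|].
  by move=> /(directed_path_le hp).
have lvl : level (n, n) = (2 * n)%N by rewrite /level /= mul2n addnn.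
have h1 := passage_time_le_mean w beta u n0 lvl hp xy.
rewrite pe in h1.
have h2 := mean_passage_time_two_pieces w_iid s0 s1 kappa_ge1 c0 gap xn yn.
have h3 := hN1 n nN1.
have h4 : 2 * Num.sqrt n%:R * deviation_sum w beta n (n, n) u
          <= 2 * n%:R `^ beta.
  apply: le_trans (_ : 2 * Num.sqrt n%:R * 1 <= _).
    by rewrite ler_pM2l // mulr_gt0.
  by rewrite mulr1 ler_pM2l.
apply: displacement_le => //; first exact: ltW.
set rho := `|_ - _| / _ in h2 *; rewrite -/beta.
have l1 : 0 <= c * rho `^ kappa by rewrite mulr_ge0 ?powR_ge0 // ltW.
have l2 : 2 * shape_function w (1, 1)
          <= 2 * shape_function w (1, 1) * n%:R `^ beta.
  by rewrite ler_peMr // mulr_ge0.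
move: h2; rewrite mulrBr mulrDl => h2.
rewrite /A; lra.
Qed.
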